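(* Let $n\ge 2$. For $\tau\in\mathcal M(\mathbb I^n)$ let $b_\tau:S^{n-1}\to\mathbb R$ be its border function with base point $o$ and $\beta_\tau=\arcsin(\tanh b_\tau)$. Call $\tau,\tau'\in\mathcal M(\mathbb I^n)$ equivalent if $\mu_{\mathrm{dS}^n}(\tau\triangle\tau')=0$. Then $\tau\mapsto\beta_\tau$ induces a bijection from the set of equivalence classes of elements of $\mathcal M(\mathbb I^n)$ onto the set of odd functions $\beta:S^{n-1}\to(-\frac{\pi}{2},\frac{\pi}{2})$ that are $1$-Lipschitz with respect to the standard spherical (geodesic) metric on $S^{n-1}$.
   Context: On $\mathbb R^{n+1}$ put $\langle x,y\rangle=-x_0y_0+x_1y_1+\cdots+x_ny_n$. Let $\mathbb I^n=\{x:\langle x,x\rangle=-1,\ x_0>0\}$ (hyperboloid model of hyperbolic space), $o=(1,0,\dots,0)$, and $\mathrm{dS}^n=\{u:\langle u,u\rangle=1\}$. Write $u(r,\omega)=(\sinh r,\cosh r\,\omega)$, $r\in\mathbb R$, $\omega\in S^{n-1}$; this parametrizes $\mathrm{dS}^n\cong\mathbb R\times S^{n-1}$, and $d\mu_{\mathrm{dS}^n}=\cosh^{n-1}r\,dr\,d\omega$ with $d\omega$ the standard measure on $S^{n-1}$. For $u\in\mathrm{dS}^n$ let $H_u=\{x\in\mathbb I^n:\langle x,u\rangle>0\}$ (open half-space) and $H_u^c=\mathbb I^n\setminus H_u$ (closed half-space). Sections. A wall is a pair $\{H_u,H_u^c\}$. A section chooses one half-space of each wall; it is identified with the set of $u\in\mathrm{dS}^n$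 such that $H_u$ is chosen. It is admissible if, whenever a chosen half-space (open or closed) is contained in a half-space $k$, then $k$ is chosen. The point section of $x\in\mathbb I^n$ is $\sigma_x=\{u\in\mathrm{dS}^n:\langle x,u\rangle>0\}$. $\mathcal M(\mathbb I^n)$ is the set of measurable admissible sections $\tau\subset\mathrm{dS}^n$ with $\mu_{\mathrm{dS}^n}(\tau\triangle\sigma_o)<\infty$. Border function. For $\tau\in\mathcal M(\mathbb I^n)$ and $\omega\in S^{n-1}$ there is a unique $b_\tau(\omega)\in\mathbb R$ such that $u(r,\omega)\in\tau$ for $r<b_\tau(\omega)$ and $u(r,\omega)\notin\tau$ for $r>b_\tau(\omega)$; $b_\tau$ is the border function of $\tau$ with base point $o$. *)

(* Defs.v *)
From HB Require Import structures.
From mathcomp Require Import all_boot all_order all_algebra.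
From mathcomp Require Import all_classical all_reals all_analysis.

Set Implicit Arguments.
Unset Strict Implicit.
Unset Printing Implicit Defensive.

Import Order.TTheory GRing.Theory Num.Theory.
Import numFieldNormedType.Exports.

Local Open Scope classical_set_scope.
Local Open Scope ring_scope.

(* Row vectors carry the sigma-algebra generated by the coordinates, as
   [n.-tuple R] does in the library; over the reals it is the Borel one. *)
Definition rV_display : measure_display. Proof. exact. Qed.

Section measurable_rV.
Context {R : realType} {n : nat}.

Definition rV_measurable : set (set 'rV[R]_n) :=
  g_sigma_preimage (fun (i : 'I_n) (x : 'rV[R]_n) => x 0 i).

Let rV_set0 : rV_measurable set0.
Proof. exact: sigma_algebra0. Qed.

Let rV_setC A : rV_measurable A -> rV_measurable (~` A).
Proof. exact: sigma_algebraC. Qed.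

Let rV_bigcup (F : (set 'rV[R]_n)^nat) :
  (forall i, rV_measurable (F i)) -> rV_measurable (\bigcup_i F i).
Proof. exact: sigma_algebra_bigcup. Qed.

HB.instance Definition _ := @isMeasurable.Build rV_display
  'rV[R]_n rV_measurable rV_set0 rV_setC rV_bigcup.

End measurable_rV.

Section hyperbolic_functions.
Context {R : realType}.
Implicit Type r : R.

Definition sinh r : R := (expR r - expR (- r)) / 2.
Definition cosh r : R := (expR r + expR (- r)) / 2.
Definition tanh r : R := sinh r / cosh r.

End hyperbolic_functions.

Section sphere.
Context {R : realType}.

Definition dot {n} (x y : 'rV[R]_n) : R := \sum_(i < n) x 0 i * y 0 i.

Definition sphere n : set 'rV[R]_n := [set w | dot w w = 1].

Definition sphere_dist {n} (v w : 'rV[R]_n) : R := acos (dot v w).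

Fixpoint lebesgue_rV n : set 'rV[R]_n -> \bar R :=
  match n with
  | 0 => \d_(0 : 'rV[R]_0)
  | m.+1 => pushforward (@lebesgue_measure R \x @lebesgue_rV m)%E
              (fun p : R * 'rV[R]_m => row_mx p.1%:M p.2 : 'rV[R]_(1 + m))
  end.

(* Surface measure of the unit sphere of R^n, extended by zero to R^n, by the
   cone formula: sigma(A) = n * Leb_n {x | 0 < |x| <= 1, x / |x| \in A}. *)
Definition sphere_measure n (A : set 'rV[R]_n) : \bar R :=
  (n%:R%:E * lebesgue_rV [set x : 'rV[R]_n |
     (0 < dot x x <= 1)%R /\ A ((Num.sqrt (dot x x))^-1 *: x)%R])%E.

End sphere.

Section deSitter.
Context {R : realType} {n : nat}.
Local Notation V := 'rV[R]_(1 + n).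

Definition lorentz (x y : V) : R :=
  - (lsubmx x 0 0 * lsubmx y 0 0) + dot (rsubmx x) (rsubmx y).

Definition hyperboloid : set V :=
  [set x | lorentz x x = -1 /\ 0 < lsubmx x 0 0].

Definition base_point : V := row_mx 1 0.

Definition dS : set V := [set u | lorentz u u = 1].

Definition dS_param (r : R) (w : 'rV[R]_n) : V :=
  row_mx (sinh r)%:M (cosh r *: w).

(* sphere_measure is carried by the sphere, so only the w in S^(n-1) count. *)
Definition dS_measure (A : set V) : \bar R :=
  (\int[@lebesgue_measure R \x @sphere_measure R n]_(p in
      [set p | A (dS_param p.1 p.2)]) (cosh p.1 ^+ n.-1)%R%:E)%E.

Definition open_half (u : V) : set V :=
  hyperboloid `&` [set x | 0 < lorentz x u].

Definition closed_half (u : V) : set V := hyperboloid `\` open_half u.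

Definition half_space (k : set V) : Prop :=
  exists2 u, dS u & k = open_half u \/ k = closed_half u.

(* A section is encoded by the set of all u such that open_half u is chosen
   from the wall {open_half u, closed_half u}. *)
Definition chosen (tau : set V) (h : set V) : Prop :=
  exists2 u, dS u & (tau u /\ h = open_half u) \/
                    (~ tau u /\ h = closed_half u).

Definition admissible (tau : set V) : Prop :=
  forall h k, chosen tau h -> half_space k -> h `<=` k -> chosen tau k.

Definition point_section (x : V) : set V := dS `&` [set u | 0 < lorentz x u].

Definition finite_sections : set (set V) :=
  [set tau | [/\ tau `<=` dS, measurable tau, admissible tau &
                 (dS_measure (tau `+` point_section base_point) < +oo)%E]].

Definition section_class (tau : set V) : set (set V) :=
  [set tau' | finite_sections tau' /\ dS_measure (tau `+` tau') = 0%E].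

Definition section_classes : set (set (set V)) :=
  [set section_class tau | tau in finite_sections].

Definition is_border (tau : set V) (w : 'rV[R]_n) (b : R) : Prop :=
  (forall r, r < b -> tau (dS_param r w)) /\
  (forall r, b < r -> ~ tau (dS_param r w)).

Definition border (tau : set V) (w : @sphere R n) : R :=
  xget 0 [set b | is_border tau (val w) b].

Definition border_angle (tau : set V) (w : @sphere R n) : R :=
  asin (tanh (border tau w)).

Definition odd_lipschitz : set (@sphere R n -> R) :=
  [set beta | [/\ forall w, - (pi / 2) < beta w < pi / 2,
                  forall v w, val v = - val w -> beta v = - beta w &
                  forall v w,
                    `|beta v - beta w| <= sphere_dist (val v) (val w)]].

End deSitter.

(* Main.v *)
(* In the Klein model the half-space of u(r, w) is the trace on the open unit
   ball of the spherical cap centred at w of angular radius pi/2 - gd r, where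
   gd r = asin (tanh r).  Hence one half-space contains another exactly when
   gd s <= gd r - d(v, w), and admissibility of a section says precisely that
   its border angle is odd and 1-Lipschitz, once the border is known to be
   finite.  If it were infinite at w, the section would contain u(s, v) for all
   s > 0 and all v in the cap at distance s around w; these caps have size about
   (cosh s)^(1-n), which cancels the density (cosh s)^(n-1), so the section
   would be at infinite distance from the base section.  Two sections with the
   same border differ inside a graph, which is null by Fubini; two different
   continuous borders differ on an open set. *)

Require Import Defs.
From HB Require Import structures.
From mathcomp Require Import all_boot all_order all_algebra.
From mathcomp Require Import all_classical all_reals all_analysis.
From mathcomp Require Import measurable_realfun.
From mathcomp Require Import ring lra.
Set Implicit Arguments.
Unset Strict Implicit.
Unset Printing Implicit Defensive.
Import Order.TTheory GRing.Theory Num.Theory.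
Import numFieldNormedType.Exports.
Local Open Scope classical_set_scope.
Local Open Scope ring_scope.

(** For a given section every inclusion of caps can be used with room to spare, so points lying
    exactly on the border never matter. The converse construction has to decide them, and there the
    asymmetry between open and closed sides bites. The vectors [u] and [-u] bound one hyperplane but
    define two walls, and the closed side of [-u] is the closure of the open side of [u]. The
    nonstrict subgraph of the border would contain both [u] and [-u]. The strict subgraph fails
    wherever the Lipschitz bound is attained between two distinct directions: a closed half-space at
    the first border point is then chosen and lies in the open half-space at the second one, tangent
    to it at infinity. A rule on the sign of the parameter breaks these ties. Finiteness of the
    constructed section is a uniform statement: compactness of the sphere keeps [beta] away from the
    ends of its range, so the difference with the base section stays in a bounded slab. The measures
    are defined as bare set functions; before Tonelli applies they are identified with bundled
    sigma-finite or finite measures. *)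

Section dot_theory.
Context {R : realType} {n : nat}.
Implicit Types x y z : 'rV[R]_n.

Lemma dotC x y : dot x y = dot y x.
Proof. by apply: eq_bigr => i _; rewrite mulrC. Qed.

Lemma dotDl x y z : dot (x + y) z = dot x z + dot y z.
Proof. by rewrite -big_split; apply: eq_bigr => i _; rewrite mxE mulrDl. Qed.

Lemma dotZl a x y : dot (a *: x) y = a * dot x y.
Proof. by rewrite mulr_sumr; apply: eq_bigr => i _; rewrite mxE mulrA. Qed.

Lemma dotNl x y : dot (- x) y = - dot x y.
Proof. by rewrite -scaleN1r dotZl mulN1r. Qed.

Lemma dotDr x y z : dot z (x + y) = dot z x + dot z y.
Proof. by rewrite !(dotC z) dotDl. Qed.

Lemma dotZr a x y : dot x (a *: y) = a * dot x y.
Proof. by rewrite !(dotC x) dotZl. Qed.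

Lemma dotNr x y : dot x (- y) = - dot x y.
Proof. by rewrite !(dotC x) dotNl. Qed.

Definition dotE := (dotDl, dotDr, dotNl, dotNr, dotZl, dotZr).

Lemma dot_ge0 x : 0 <= dot x x.
Proof. by apply: sumr_ge0 => i _; rewrite -expr2 sqr_ge0. Qed.

Lemma dot_eq0 x : dot x x = 0 -> x = 0.
Proof.
move=> /eqP; rewrite psumr_eq0 => [/allP h|i _]; last by rewrite -expr2 sqr_ge0.
apply/rowP => i; rewrite mxE; have := h i; rewrite mem_index_enum => /(_ isT).
by rewrite mulf_eq0 orbb => /eqP.
Qed.

(** The squared norm of [dot y y *: x - dot x y *: y] is [dot y y] times the defect of the
    inequality. *)
Lemma Cauchy_Schwarz_dot x y : dot x y ^+ 2 <= dot x x * dot y y.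
Proof.
have [y0|y0] := eqVneq (dot y y) 0.
  rewrite (dot_eq0 y0) -(scale0r y) !dotZr !mul0r mulr0 expr0n.
  by rewrite le_refl.
have yp : 0 < dot y y by rewrite lt0r y0 dot_ge0.
have := dot_ge0 (dot y y *: x - dot x y *: y).
rewrite !dotE (dotC y x) => h.
rewrite -subr_ge0 -(pmulr_rge0 _ yp); apply: le_trans h _.
by rewrite le_eqVlt; apply/orP; left; apply/eqP; ring.
Qed.

Lemma dot_unit_bound x y : dot x x <= 1 -> dot y y = 1 -> -1 <= dot x y <= 1.
Proof.
move=> x1 y1; rewrite -ler_norml -(@ler_pXn2r _ 2) ?nnegrE ?normr_ge0//.
by rewrite expr1n real_normK ?num_real// (le_trans (Cauchy_Schwarz_dot _ _))// y1 mulr1.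
Qed.

Lemma dot_sphere_eq x y : dot x x = 1 -> dot y y = 1 -> dot x y = 1 -> x = y.
Proof.
move=> x1 y1 xy; apply/eqP; rewrite -subr_eq0; apply/eqP/dot_eq0.
by rewrite !dotE (dotC y x) x1 y1 xy; ring.
Qed.

End dot_theory.

(** * Hyperbolic functions and the Gudermannian *)

Section hyperbolic_trigonometry.
Context {R : realType}.
Implicit Types r s t : R.

Lemma coshN r : cosh (- r) = cosh r.
Proof. by rewrite /cosh opprK addrC. Qed.

Lemma sinhN r : sinh (- r) = - sinh r.
Proof. by rewrite /sinh opprK -mulNr opprB. Qed.

Lemma cosh2Bsinh2 r : cosh r ^+ 2 - sinh r ^+ 2 = 1.
Proof.
have e : expR r * expR (- r) = 1 by rewrite -expRD subrr expR0.
by rewrite /cosh /sinh -[RHS]e; field.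
Qed.

Lemma cosh_gt0 r : 0 < cosh r.
Proof. by rewrite divr_gt0// addr_gt0// expR_gt0. Qed.

Lemma cosh_ge1 r : 1 <= cosh r.
Proof.
have h := cosh2Bsinh2 r; have := sqr_ge0 (sinh r); have := cosh_gt0 r.
by nra.
Qed.

Lemma tanhN r : tanh (- r) = - tanh r.
Proof. by rewrite /tanh sinhN coshN mulNr. Qed.

(** With a single exponential left, monotonicity, bounds and inversion of [tanh] can be read off. *)
Lemma tanhE r : tanh r = 1 - 2 / (expR (r *+ 2) + 1).
Proof.
have e0 := expR_gt0 r; rewrite mulr2n expRD /tanh /sinh /cosh expRN.
by field; apply/andP; split; nra.
Qed.

Lemma tanh_mono : {mono @tanh R : r s / r < s}.
Proof.
apply: leW_mono; apply: le_mono => r s rs; rewrite !tanhE ltrD2l ltrN2.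
rewrite ltr_pM2l// ltf_pV2 ?posrE ?addr_gt0 ?expR_gt0// ltrD2r ltr_expR.
by rewrite ltrMn2r.
Qed.

Lemma tanh_bound r : -1 < tanh r < 1.
Proof.
have e0 := expR_gt0 (r *+ 2); have := divr_gt0 (@ltr0Sn R 1) (addr_gt0 e0 ltr01).
rewrite tanhE => h; apply/andP; split; last by lra.
suff : 2 / (expR (r *+ 2) + 1) < 2 by lra.
by rewrite ltr_pdivrMr; nra.
Qed.

Lemma tanh_surj t : -1 < t < 1 -> exists r, tanh r = t.
Proof.
move=> /andP[t1 t2]; exists (ln ((1 + t) / (1 - t)) / 2).
have q0 : 0 < (1 + t) / (1 - t) by rewrite divr_gt0; lra.
rewrite tanhE (_ : _ *+ 2 = ln ((1 + t) / (1 - t))) ?lnK ?posrE//; last by field.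
by field; apply/andP; split; lra.
Qed.

Lemma sinh_surj t : exists r, sinh r = t.
Proof.
have h0 : 0 <= t ^+ 2 + 1 by rewrite addr_ge0// sqr_ge0.
have s0 := sqrtr_ge0 (t ^+ 2 + 1).
have s2 := sqr_sqrtr h0.
set s := Num.sqrt _ in s0 s2.
have ts : 0 < t + s by nra.
exists (ln (t + s)); rewrite /sinh expRN lnK ?posrE//.
apply: (mulIf (lt0r_neq0 ts)); field: s2; lra.
Qed.

(** The Gudermannian function, an odd increasing bijection of the line onto the interval from -pi/2
    to pi/2. *)
Definition gd r := asin (tanh r).

Lemma tanh_itv r : -1 <= tanh r <= 1.
Proof. by case/andP: (tanh_bound r) => /ltW -> /ltW ->. Qed.

Lemma sin_gd r : sin (gd r) = tanh r.
Proof. by rewrite asinK// in_itv/= tanh_itv. Qed.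

Lemma gd_bound r : - (pi / 2) < gd r < pi / 2.
Proof.
case/andP: (tanh_bound r) => h1 h2; rewrite asin_gtNpi2 ?h1 ?ltW//.
by rewrite asin_ltpi2 ?h2 ?ltW.
Qed.

Lemma sin_lt (x y : R) : - (pi / 2) <= x <= pi / 2 -> - (pi / 2) <= y <= pi / 2 ->
  (sin x < sin y) = (x < y).
Proof. by move=> hx hy; rewrite ltr_sin ?in_itv. Qed.

Lemma sin_le (x y : R) : - (pi / 2) <= x <= pi / 2 -> - (pi / 2) <= y <= pi / 2 ->
  (sin x <= sin y) = (x <= y).
Proof. by move=> hx hy; rewrite !leNgt sin_lt. Qed.

Lemma sin_bound t : - (pi / 2) < t < pi / 2 -> -1 < sin t < 1.
Proof.
move=> /andP[t1 t2]; have pi0 := pi_gt0 R.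
rewrite -[X in _ < _ < X]sin_pihalf -[X in X < _](congr1 -%R (@sin_pihalf R)) -sinN.
by rewrite !sin_lt ?t1 ?t2//; apply/andP; split; lra.
Qed.

Lemma gd_itv r : - (pi / 2) <= gd r <= pi / 2.
Proof. by case/andP: (gd_bound r) => /ltW -> /ltW ->. Qed.

Lemma gd_mono : {mono gd : r s / r < s}.
Proof. by move=> r s; rewrite -sin_lt ?gd_itv// !sin_gd tanh_mono. Qed.

Lemma gd_inj : injective gd.
Proof.
move=> r s e; apply: le_anti.
by rewrite !leNgt -(gd_mono r) -(gd_mono s) e ltxx.
Qed.

Lemma gdN r : gd (- r) = - gd r.
Proof.
apply: sin_inj; rewrite ?in_itv/= ?gd_itv//.
  by rewrite lerNl opprK lerNl; case/andP: (gd_itv r) => -> ->.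
by rewrite sin_gd tanhN sinN sin_gd.
Qed.

Lemma gd0 : gd 0 = 0.
Proof. by have := gdN (0 : R); rewrite oppr0; lra. Qed.

Lemma gd_surj t : - (pi / 2) < t < pi / 2 -> exists r, gd r = t.
Proof.
move=> /andP[t1 t2]; have tI : - (pi / 2) <= t <= pi / 2 by rewrite !ltW.
have pi0 := pi_gt0 R.
have [|r rt] := @tanh_surj (sin t); first by rewrite sin_bound ?t1.
by exists r; rewrite /gd rt sinK// in_itv.
Qed.

End hyperbolic_trigonometry.

(** * Inclusion of spherical caps *)

Section spherical_caps.
Context {R : realType} {n : nat}.
Implicit Types (x y v w : 'rV[R]_n) (a b t : R).

Lemma sphere_dist_itv v w : dot v v = 1 -> dot w w = 1 ->
  0 <= sphere_dist v w <= pi.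
Proof.
move=> v1 w1; have h : -1 <= dot v w <= 1 by apply: dot_unit_bound; rewrite ?v1.
by rewrite acos_ge0 ?acos_lepi.
Qed.

Lemma cos_sphere_dist v w : dot v v = 1 -> dot w w = 1 ->
  cos (sphere_dist v w) = dot v w.
Proof.
by move=> v1 w1; rewrite acosK// in_itv/= dot_unit_bound ?v1.
Qed.

Lemma sphere_dist_sym v w : sphere_dist v w = sphere_dist w v.
Proof. by rewrite /sphere_dist dotC. Qed.

Lemma sphere_dist0 v w : dot v v = 1 -> dot w w = 1 ->
  sphere_dist v w = 0 -> v = w.
Proof.
by move=> v1 w1 d0; apply: dot_sphere_eq => //; rewrite -cos_sphere_dist// d0 cos0.
Qed.

Lemma sphere_distxx v : dot v v = 1 -> sphere_dist v v = 0.
Proof. by rewrite /sphere_dist => ->; rewrite acos1. Qed.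

(* Cauchy-Schwarz for the components of [y] and [w] orthogonal to [v]. *)
Lemma dot_residual v w y : dot v v = 1 -> dot w w = 1 ->
  (dot y w - dot y v * dot v w) ^+ 2 <=
    (dot y y - dot y v ^+ 2) * (1 - dot v w ^+ 2).
Proof.
move=> v1 w1.
have := Cauchy_Schwarz_dot (y - dot y v *: v) (w - dot v w *: v).
rewrite !dotE (dotC w v) (dotC v y) v1 w1; set p := dot y v; set c := dot v w.
rewrite !mulr1 => h; apply: le_trans (le_trans h _);
  rewrite le_eqVlt; apply/orP; left; apply/eqP; ring.
Qed.

Lemma sin_sqE t : sin t ^+ 2 = 1 - cos t ^+ 2.
Proof. by have := cos2Dsin2 t; lra. Qed.

(** For unit [y] this is the triangle inequality for angles. The residual bound gives
    [dot y w >= p cos d - sqrt(1 - p^2) sin d] with [p = dot y v], which is the subtraction formula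
    for the sine; this form covers the whole ball and needs no restriction on the range of the
    difference. *)
Lemma dot_ge_sin v w y : dot v v = 1 -> dot w w = 1 -> dot y y <= 1 ->
  sin (asin (dot y v) - sphere_dist v w) <= dot y w.
Proof.
move=> v1 w1 y1; have pb := dot_unit_bound y1 v1.
have /andP[d0 dpi] := sphere_dist_itv v1 w1.
have s0 : 0 <= sin (sphere_dist v w) by rewrite sin_ge0_pi// d0.
have := dot_residual y v1 w1.
rewrite -(cos_sphere_dist v1 w1) -sin_sqE sinB asinK ?in_itv//= => h.
have c0 : 0 <= cos (asin (dot y v)).
  by rewrite cos_ge0_pihalf// asin_geNpi2// asin_lepi2.
have c2 := sin_sqE (asin (dot y v)); rewrite asinK ?in_itv//= in c2.
set q := dot y w in h *; set p := dot y v in h c2 c0 *.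
set c := cos (asin _) in c0 c2 *; set s := sin _ in h s0 *; set k := cos _ in h *.
have h2 : (q - p * k) ^+ 2 <= (c * s) ^+ 2.
  apply: le_trans h _; rewrite exprMn ler_wpM2r ?sqr_ge0//; lra.
have cs0 : 0 <= c * s by rewrite mulr_ge0.
suff : - (c * s) <= q - p * k by lra.
by move: (c * s) (q - p * k) h2 cs0 => Y X; nra.
Qed.

(** Inside the open ball the residual of [y] is strictly shorter than on the sphere. This is why
    caps tangent at infinity are strictly nested in the Klein ball. *)
Lemma dot_gt_sin v w y : dot v v = 1 -> dot w w = 1 -> dot y y < 1 ->
  0 < sin (sphere_dist v w) ->
  sin (asin (dot y v) - sphere_dist v w) < dot y w.
Proof.
move=> v1 w1 y1 s0; have pb := dot_unit_bound (ltW y1) v1.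
have := dot_residual y v1 w1.
rewrite -(cos_sphere_dist v1 w1) -sin_sqE sinB asinK ?in_itv//= => h.
have c0 : 0 <= cos (asin (dot y v)).
  by rewrite cos_ge0_pihalf// asin_geNpi2// asin_lepi2.
have c2 := sin_sqE (asin (dot y v)); rewrite asinK ?in_itv//= in c2.
set q := dot y w in h *; set p := dot y v in h c2 c0 *.
set c := cos (asin _) in c0 c2 *; set s := sin _ in h s0 *; set k := cos _ in h *.
have h2 : (q - p * k) ^+ 2 < (c * s) ^+ 2.
  apply: le_lt_trans h _; rewrite exprMn ltr_pM2r ?exprn_gt0//; lra.
have cs0 : 0 <= c * s by rewrite mulr_ge0// ltW.
suff : - (c * s) < q - p * k by lra.
by move: (c * s) (q - p * k) h2 cs0 => Y X; nra.
Qed.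

(** A cap of height [sin a] has angular radius pi/2 - a, so this says that the first radius plus the
    distance of the centres is at most the second radius. *)
Definition cap_le a v b w := b <= a - sphere_dist v w.

Section cap_inclusion.
Variables (a b : R) (v w : 'rV[R]_n).
Hypotheses (v1 : dot v v = 1) (w1 : dot w w = 1).
Hypotheses (ha : - (pi / 2) < a < pi / 2) (hb : - (pi / 2) < b < pi / 2).

Lemma cap_le_ball : cap_le a v b w -> forall y, dot y y < 1 ->
  sin a <= dot y v -> (sin a < dot y v) \/ (a, v) <> (b, w) -> sin b < dot y w.
Proof.
move=> hab y y1 ay st; have pb := dot_unit_bound (ltW y1) v1.
case/andP: ha => ha1 ha2; case/andP: hb => hb1 hb2.
have /andP[d0 dpi] := sphere_dist_itv v1 w1.
set p := asin (dot y v).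
have p1 : - (pi / 2) <= p <= pi / 2 by rewrite asin_geNpi2// asin_lepi2.
have sp : sin p = dot y v by rewrite asinK// in_itv.
have ap : a <= p by rewrite -sin_le ?sp// !ltW.
have hd := hab; rewrite /cap_le in hd.
case/andP: (p1) => p2 p3.
have I : - (pi / 2) <= p - sphere_dist v w <= pi / 2 by apply/andP; split; lra.
have Ib : - (pi / 2) <= b <= pi / 2 by apply/andP; split; lra.
have [dp|] := ltP 0 (sphere_dist v w).
  apply: le_lt_trans (dot_gt_sin v1 w1 y1 _); last first.
    (* The distance is below pi because [cap_le] bounds it by [a - b], and both angles lie strictly
       between -pi/2 and pi/2. *)
    rewrite sin_gt0_pi// dp/=; lra.
  by rewrite sin_le//; rewrite -/p; lra.
move=> dn; have d00 : sphere_dist v w = 0 by apply/eqP; rewrite eq_le dn.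
apply: lt_le_trans (dot_ge_sin v1 w1 (ltW y1)).
rewrite sin_lt// -/p d00 subr0; rewrite d00 subr0 in hd.
case: st => [ayl|ne].
  apply: le_lt_trans hd _; rewrite -sin_lt ?sp//; apply/andP; split; lra.
apply: lt_le_trans ap; rewrite lt_neqAle hd andbT; apply/eqP => eab.
by apply: ne; rewrite eab (sphere_dist0 v1 w1 d00).
Qed.

(** A point of the closed cap is a limit of points of the open ball strictly inside the cap. The
    closure is needed because the extremal points that test an inclusion lie on the boundary. *)
Lemma ball_le_closed : (forall y, dot y y < 1 -> sin a < dot y v -> sin b <= dot y w) ->
  forall y, dot y y <= 1 -> sin a <= dot y v -> sin b <= dot y w.
Proof.
move=> H y y1 ay.
have /andP[sa0 sa1] := sin_bound ha.
(* [k] lies strictly between [sin a] and 1, so [k *: v] is interior both to the ball and to the cap,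
   and so is every proper mixture of it with [y]. *)
pose k := (sin a + 1) / 2.
have K t : 0 < t <= 1 -> sin b <= (1 - t) * dot y w + t * (k * dot v w).
  move=> /andP[t0 t1].
  have -> : (1 - t) * dot y w + t * (k * dot v w) =
    dot ((1 - t) *: y + (t * k) *: v) w.
    by rewrite !dotE; ring.
  apply: H.
    rewrite !dotE v1 (dotC v y).
    have /andP[p1 p2] := dot_unit_bound y1 v1; set p := dot y v in ay p1 p2 *.
    set q := dot y y in y1 *; have k0 : 0 < k < 1 by rewrite /k; lra.
    have hk : `|k| < 1 by rewrite ger0_norm; lra.
    have A : 0 <= (1 - t) * (t * k) * (1 - p).
      by apply: mulr_ge0; [apply: mulr_ge0; [lra|apply: mulr_ge0; lra]|lra].
    have B : 0 <= (1 - t) * (1 - t) * (1 - q).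
      by apply: mulr_ge0; [apply: mulr_ge0; lra|lra].
    have C : 0 < t * (1 - k) by apply: mulr_gt0; lra.
    have D : 0 <= (1 - t) + t * k by apply: addr_ge0; [lra|apply: mulr_ge0; lra].
    have : ((1 - t) + t * k) ^+ 2 < 1 by rewrite expr_lt1//; nra.
    by nra.
  rewrite !dotE v1; have hk : sin a < k by rewrite /k; lra.
  have : 0 <= (1 - t) * (dot y v - sin a) by apply: mulr_ge0; lra.
  have : 0 < t * (k - sin a) by apply: mulr_gt0; lra.
  by lra.
rewrite leNgt; apply/negP => lt.
(* An explicit [t] replaces the limit: the bound at [t] reads [e <= t * M], while
   [t * (|M| + 1 + e) = e] forces [t * M < e]. *)
pose e := sin b - dot y w; pose M := k * dot v w - dot y w.
have e0 : 0 < e by rewrite /e; lra.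
have M0 : 0 < `|M| + 1 + e by have := normr_ge0 M; lra.
have := K (e / (`|M| + 1 + e)); rewrite divr_gt0//= ler_pdivrMr// mul1r => h.
have {}h := h (ltac:(have := normr_ge0 M; lra)).
set t := e / _ in h.
have t0 : 0 < t by rewrite divr_gt0.
have te : t * (`|M| + 1 + e) = e by rewrite /t divfK// lt0r_neq0.
have hM := ler_norm M.
have : t * M <= t * `|M| by rewrite ler_pM2l.
have : 0 < t * (1 + e) by apply: mulr_gt0; lra.
by rewrite /e /M in te *; lra.
Qed.

(** The hypothesis is tested at the point of the first cap farthest from [w]. *)
Lemma ball_cap_le : (forall y, dot y y < 1 -> sin a < dot y v -> sin b <= dot y w) ->
  cap_le a v b w.
Proof.
move=> /ball_le_closed H.
case/andP: ha => ha1 ha2; case/andP: hb => hb1 hb2.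
have /andP[d0 dpi] := sphere_dist_itv v1 w1.
have cd := cos_sphere_dist v1 w1.
have /andP[sb1 _] := sin_bound hb.
rewrite /cap_le; have [small|big] := ltP (a - sphere_dist v w) (- (pi / 2)).
  (* Here the first cap contains the antipode [- w], which cannot belong to a cap centred at [w]
     with [sin b > -1]. *)
  suff : sin b <= dot (- w) w by rewrite dotNl w1; lra.
  apply: H; first by rewrite !dotE opprK w1.
  rewrite dotNl dotC -cd -sinBpihalf sin_le; lra.
set d := sphere_dist v w in d0 dpi cd big *.
(* [f] is the unit tangent at [v] towards [w], and the farthest point is [sin a *: v - cos a *: f].
   If [sin d = 0] the inverse is 0 and [f = 0]; both [dot f w = sin d] and [dot f f <= 1] still
   hold. *)
pose f := (sin d)^-1 *: (w - cos d *: v).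
have fv : dot f v = 0 by rewrite !dotE v1 (dotC w v) cd; ring.
have s2 := sin_sqE d.
have fw : dot f w = sin d.
  rewrite !dotE w1 -cd -expr2 -s2; have [->|sd] := eqVneq (sin d) 0.
    by rewrite invr0 mul0r.
  by rewrite expr2 mulKf.
have ff : dot f f <= 1.
  have -> : dot f f = (sin d)^-1 * (dot f w - cos d * dot f v).
    by rewrite {2}/f dotZr dotDr dotNr dotZr.
  rewrite fv fw mulr0 subr0.
  by have [->|sd] := eqVneq (sin d) 0; rewrite ?mulr0 ?mulVf// ler01.
move: f fv fw ff => f fv fw ff.
suff : sin b <= dot (sin a *: v - cos a *: f) w.
  rewrite !dotE fw -cd (mulrC (sin a)) (mulrC (cos d)) -sinB sin_le//.
    by apply/andP; split; lra.
  by apply/andP; split; lra.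
apply: H; last by rewrite !dotE fv v1; lra.
rewrite !dotE (dotC v f) fv v1.
have := sin_sqE a; have := sqr_ge0 (cos a); set c := cos a; set s := sin a.
by nra.
Qed.

End cap_inclusion.
End spherical_caps.

(** * Half-spaces and admissible sections *)

Section half_spaces.
Context {R : realType} {n : nat}.
Local Notation V := 'rV[R]_(1 + n).
Implicit Types (x u : V) (v w y : 'rV[R]_n) (r s : R) (tau : set V).

Definition klein x : 'rV[R]_n := (lsubmx x 0 0)^-1 *: rsubmx x.

Lemma lsub_dS_param r w : lsubmx (dS_param r w) 0 0 = sinh r.
Proof. by rewrite row_mxKl mxE eqxx. Qed.

Lemma rsub_dS_param r w : rsubmx (dS_param r w) = cosh r *: w.
Proof. exact: row_mxKr. Qed.

Lemma lorentz_dS_param x r w : 0 < lsubmx x 0 0 ->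
  lorentz x (dS_param r w) =
    lsubmx x 0 0 * cosh r * (dot (klein x) w - tanh r).
Proof.
move=> x0; have c0 := cosh_gt0 r.
rewrite /lorentz lsub_dS_param rsub_dS_param /klein dotZl dotZr /tanh.
by field; rewrite !lt0r_neq0.
Qed.

Lemma klein_lt1 x : hyperboloid x -> dot (klein x) (klein x) < 1.
Proof.
move=> [h x0]; rewrite /klein dotZl dotZr mulrA -invfM mulrC ltr_pdivrMr ?mulr_gt0//.
by rewrite mul1r; move: h; rewrite /lorentz; lra.
Qed.

Lemma klein_surj y : dot y y < 1 -> exists2 x, hyperboloid x & klein x = y.
Proof.
move=> y1; pose a := (Num.sqrt (1 - dot y y))^-1.
have s0 : 0 < Num.sqrt (1 - dot y y) by rewrite sqrtr_gt0 subr_gt0.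
have a0 : 0 < a by rewrite invr_gt0.
have a2 : a ^+ 2 * (1 - dot y y) = 1.
  by rewrite exprVn sqr_sqrtr ?mulVf//; lra.
have l : lsubmx (row_mx a%:M (a *: y)) 0 0 = a by rewrite row_mxKl mxE eqxx.
exists (row_mx a%:M (a *: y)).
  split; last by rewrite l.
  by rewrite /lorentz l row_mxKr dotZl dotZr; move: a2; rewrite expr2; lra.
by rewrite /klein l row_mxKr scalerA mulVf ?scale1r// lt0r_neq0.
Qed.

Lemma open_halfE r w x :
  open_half (dS_param r w) x <-> hyperboloid x /\ tanh r < dot (klein x) w.
Proof.
have K : hyperboloid x -> (0 < lorentz x (dS_param r w)) = (tanh r < dot (klein x) w).
  move=> [_ x0]; rewrite lorentz_dS_param// pmulr_rgt0 ?subr_gt0//.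
  by apply: mulr_gt0 => //; exact: cosh_gt0.
by split=> [[hx h]|[hx h]]; split=> //; [rewrite -K|rewrite /= K].
Qed.

(** The parameters [(- r, - w)] give the opposite vector, whose closed side is the closure of the
    open side for [(r, w)]. Open and closed caps are thus described by the same pair. *)
Lemma closed_halfE r w x : closed_half (dS_param (- r) (- w)) x <->
  hyperboloid x /\ tanh r <= dot (klein x) w.
Proof.
split=> [[hx h]|[hx h]].
  split=> //; rewrite leNgt; apply/negP => lt; apply: h; apply/open_halfE.
  by split=> //; rewrite tanhN dotNr ltrN2.
by split=> // /open_halfE[_]; rewrite tanhN dotNr ltrN2 ltNge h.
Qed.

Lemma dS_dS_param r w : dS (dS_param r w) <-> dot w w = 1.
Proof.
rewrite /dS /= /lorentz lsub_dS_param rsub_dS_param dotZl dotZr.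
have := cosh2Bsinh2 r; have := cosh_gt0 r; rewrite !expr2 => c0 cs.
split=> [h|->]; last by lra.
by apply: (mulfI (lt0r_neq0 (mulr_gt0 c0 c0))); lra.
Qed.

Lemma dS_paramP u : dS u -> exists r w, dot w w = 1 /\ u = dS_param r w.
Proof.
move=> du; have [r hr] := sinh_surj (lsubmx u 0 0).
have E : u = dS_param r ((cosh r)^-1 *: rsubmx u).
  rewrite -[LHS]hsubmxK /dS_param hr scalerA divff ?lt0r_neq0 ?cosh_gt0// scale1r.
  by congr row_mx; apply/matrixP => i j; rewrite !ord1 [RHS]mxE eqxx.
exists r, ((cosh r)^-1 *: rsubmx u); split=> //.
by apply/(@dS_dS_param r); rewrite -E.
Qed.

Lemma sphereN w : dot w w = 1 -> dot (- w) (- w) = 1.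
Proof. by rewrite dotNl dotNr opprK. Qed.

Lemma ball_klein (P : 'rV[R]_n -> Prop) :
  (forall x, hyperboloid x -> P (klein x)) -> forall y, dot y y < 1 -> P y.
Proof. by move=> H y /klein_surj[x hx <-]; apply: H. Qed.

Section inclusion.
Variables (r s : R) (v w : 'rV[R]_n).
Hypotheses (v1 : dot v v = 1) (w1 : dot w w = 1).

Lemma cap_le_half : cap_le (gd r) v (gd s) w -> forall x, hyperboloid x ->
  tanh r <= dot (klein x) v -> (tanh r < dot (klein x) v) \/ (r, v) <> (s, w) ->
  tanh s < dot (klein x) w.
Proof.
move=> c x hx; rewrite -!sin_gd => h1 h2.
apply: (cap_le_ball v1 w1 (gd_bound r) (gd_bound s) c (klein_lt1 hx)) => //.
by case: h2 => [|h]; [left|right=> -[/gd_inj rs vw]; apply: h; rewrite rs vw].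
Qed.

Lemma half_cap_le : (forall x, hyperboloid x ->
  tanh r < dot (klein x) v -> tanh s <= dot (klein x) w) ->
  cap_le (gd r) v (gd s) w.
Proof.
move=> H; apply: (ball_cap_le v1 w1 (gd_bound r) (gd_bound s)).
by apply: ball_klein => x hx; rewrite !sin_gd; exact: H.
Qed.

(** Adding the two inequalities leaves a nonpositive distance. *)
Lemma cap_le_anti : cap_le (gd r) v (gd s) w -> cap_le (gd s) w (gd r) v ->
  (r, v) = (s, w).
Proof.
rewrite /cap_le (sphere_dist_sym w) => h1 h2.
have /andP[d0 _] := sphere_dist_itv v1 w1.
have /(sphere_dist0 v1 w1)-> : sphere_dist v w = 0 by lra.
by congr (_, _); apply: gd_inj; lra.
Qed.

Lemma open_half_inj : open_half (dS_param r v) = open_half (dS_param s w) ->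
  (r, v) = (s, w).
Proof.
move=> E; apply: cap_le_anti.
  apply: half_cap_le => x hx h.
  have /open_halfE[_ /ltW//] : open_half (dS_param s w) x by rewrite -E; apply/open_halfE.
have : open_half (dS_param s w) `<=` open_half (dS_param r v) by rewrite E.
move=> I; rewrite /cap_le.
apply: (ball_cap_le w1 v1 (gd_bound s) (gd_bound r)).
apply: ball_klein => x hx; rewrite !sin_gd => h.
have /open_halfE[_ /ltW//] : open_half (dS_param r v) x by apply: I; apply/open_halfE.
Qed.

(** Equality would force equal parameters, and then the Klein point [tanh r *: v] lies in the closed
    side only. With the injectivity lemmas this makes [chosen] unambiguous. *)
Lemma open_half_neq_closed_half :
  open_half (dS_param r v) <> closed_half (dS_param (- s) (- w)).
Proof.
move=> E; have rvsw : (r, v) = (s, w).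
  apply: cap_le_anti.
    apply: half_cap_le => x hx h.
    by have /closed_halfE[] : closed_half (dS_param (- s) (- w)) x by rewrite -E; apply/open_halfE.
  apply: (ball_cap_le w1 v1 (gd_bound s) (gd_bound r)).
  apply: ball_klein => x hx; rewrite !sin_gd => h.
  have /open_halfE[_ /ltW//] : open_half (dS_param r v) x.
  by rewrite E; apply/closed_halfE; split=> //; exact: ltW.
have [|x hx kx] := @klein_surj (tanh r *: v).
  by rewrite dotZl dotZr v1 mulr1; case/andP: (tanh_bound r) => h1 h2; nra.
have : closed_half (dS_param (- s) (- w)) x.
  by apply/closed_halfE; case: rvsw => <- <-; rewrite kx dotZl v1 mulr1.
by rewrite -E => /open_halfE[_]; rewrite kx dotZl v1 mulr1 ltxx.
Qed.

End inclusion.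

Lemma open_half_dS_inj u u' : dS u -> dS u' -> open_half u = open_half u' -> u = u'.
Proof.
move=> /dS_paramP[r [v [v1 ->]]] /dS_paramP[s [w [w1 ->]]].
by move=> /(open_half_inj v1 w1)[-> ->].
Qed.

Lemma open_half_neq_closed_half_dS u u' : dS u -> dS u' ->
  open_half u <> closed_half u'.
Proof.
move=> /dS_paramP[r [v [v1 ->]]] /dS_paramP[s [w [w1 ->]]].
rewrite -[s]opprK -[w]opprK; apply: open_half_neq_closed_half => //.
exact: sphereN.
Qed.

Lemma closed_half_dS_inj u u' : dS u -> dS u' -> closed_half u = closed_half u' -> u = u'.
Proof.
move=> du du' E; apply: open_half_dS_inj => //.
have K z : open_half z = hyperboloid `\` closed_half z.
  by rewrite /closed_half setDD setIidr// => x [].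
by rewrite K E -K.
Qed.

Lemma chosen_open_half tau u : dS u -> chosen tau (open_half u) <-> tau u.
Proof.
move=> du; split=> [[u' du' [[tu']|[_ E]]]|tu].
- by move=> /(open_half_dS_inj du du') ->.
- by have := open_half_neq_closed_half_dS du du' E.
- by exists u => //; left.
Qed.

Lemma chosen_closed_half tau u : dS u -> chosen tau (closed_half u) <-> ~ tau u.
Proof.
move=> du; split=> [[u' du' [[_ E]|[tu']]]|tu].
- by have := open_half_neq_closed_half_dS du' du (esym E).
- by move=> /(closed_half_dS_inj du du') ->.
- by exists u => //; right.
Qed.

(* In the Klein model [open_half] of (r, v) and [closed_half] of (-r, -v) are
   an open ball cap and its closure; a closed cap lies in a different open cap
   even when their boundary spheres are tangent at infinity. *)
Lemma admissibleP tau : admissible tau <->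
  (forall r v, dot v v = 1 -> tau (dS_param r v) -> ~ tau (dS_param (- r) (- v))) /\
  (forall r v s w, dot v v = 1 -> dot w w = 1 -> ~ tau (dS_param (- r) (- v)) ->
     cap_le (gd r) v (gd s) w -> (r, v) <> (s, w) -> tau (dS_param s w)).
Proof.
have D r v : dot v v = 1 -> dS (dS_param r v) by move/dS_dS_param.
have DN r v : dot v v = 1 -> dS (dS_param (- r) (- v)) by move/sphereN/D.
split=> [adm|[F3 F2] h k].
  split=> [r v v1 t|r v s w v1 w1 t c ne].
    apply/chosen_closed_half; first exact: DN.
    apply: (adm (open_half (dS_param r v))).
    - by apply/chosen_open_half => //; exact: D.
    - by exists (dS_param (- r) (- v)); [exact: DN|right].
    - by move=> x /open_halfE[hx /ltW hr]; apply/closed_halfE.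
  apply/chosen_open_half; first exact: D.
  apply: (adm (closed_half (dS_param (- r) (- v)))).
  - by apply/chosen_closed_half => //; exact: DN.
  - by exists (dS_param s w); [exact: D|left].
  - move=> x /closed_halfE[hx hr]; apply/open_halfE; split=> //.
    by apply: (cap_le_half v1 w1 c) => //; right.
(* A chosen closed side passes to larger closed sides: through the open side by the second
   condition, then back to its closure by the first. *)
have F r v s w : dot v v = 1 -> dot w w = 1 -> ~ tau (dS_param (- r) (- v)) ->
    cap_le (gd r) v (gd s) w -> ~ tau (dS_param (- s) (- w)).
  move=> v1 w1 t c; have [[<- <-]//|/eqP ne] := eqVneq (r, v) (s, w).
  by apply: F3 => //; apply: F2 c ne.
(* Four cases, by the type of the smaller and of the larger half-space; a closed one is rewritten
   with double negations so that [closed_halfE] applies. *)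
move=> [_ /dS_paramP[r [v [v1 ->]]] [[tu ->]|[tu ->]]] [_ /dS_paramP[s [w [w1 ->]]] [->|->]] hk.
- apply/chosen_open_half; first exact: D.
  have [[<- <-]//|/eqP ne] := eqVneq (r, v) (s, w).
  apply: (F2 r v) => //; first exact: F3.
  apply: half_cap_le => // x hx hr.
  by have /open_halfE[_ /ltW] : open_half (dS_param s w) x by apply: hk; apply/open_halfE.
- move: hk; rewrite -[s]opprK -[w]opprK => hk; have w1' := sphereN w1.
  apply/chosen_closed_half; first exact: DN.
  apply: (F r v) => //; first exact: F3.
  apply: half_cap_le => // x hx hr.
  have /closed_halfE[_//] : closed_half (dS_param (- - s) (- - w)) x.
  by apply: hk; apply/open_halfE.
- move: tu hk; rewrite -[r]opprK -[v]opprK => tu hk; have v1' := sphereN v1.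
  apply/chosen_open_half; first exact: D.
  (* With equal parameters a closed cap would lie in its own interior, which its boundary point
     [tanh s *: w] refutes. *)
  have [E|/eqP ne] := eqVneq (- r, - v) (s, w).
    have [|x hx kx] := @klein_surj (tanh s *: w).
      by rewrite dotZl dotZr w1 mulr1; case/andP: (tanh_bound s) => h1 h2; nra.
    have /open_halfE[_] : open_half (dS_param s w) x.
      by apply: hk; apply/closed_halfE; case: E => -> ->; rewrite kx dotZl w1 mulr1.
    by rewrite kx dotZl w1 mulr1 ltxx.
  apply: (F2 (- r) (- v)) => //.
  apply: half_cap_le => // x hx hr.
  have /open_halfE[_ /ltW//] : open_half (dS_param s w) x.
  by apply: hk; apply/closed_halfE; split=> //; exact: ltW.
- move: tu hk; rewrite -[r]opprK -[v]opprK -[s]opprK -[w]opprK => tu hk.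
  have v1' := sphereN v1; have w1' := sphereN w1.
  apply/chosen_closed_half; first exact: DN.
  apply: (F (- r) (- v)) => //.
  apply: half_cap_le => // x hx hr.
  have /closed_halfE[_//] : closed_half (dS_param (- - s) (- - w)) x.
  by apply: hk; apply/closed_halfE; split=> //; exact: ltW.
Qed.

End half_spaces.

(** * Lebesgue measure on row vectors *)

Section row_vector_measurability.
Context {R : realType}.

Lemma measurable_coord n (i : 'I_n) : measurable_fun setT (fun x : 'rV[R]_n => x 0 i).
Proof.
move=> _ Y mY; rewrite setTI; apply: sub_sigma_algebra => /=.
rewrite -bigcup_seq/=; exists i => /=; first by rewrite mem_index_enum.
by exists Y => //; rewrite setTI.
Qed.

Context d (T : measurableType d).

Lemma measurable_fun_rV n (f : T -> 'rV[R]_n) :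
  (forall i, measurable_fun setT (fun t => f t 0 i)) -> measurable_fun setT f.
Proof.
move=> mf _ A mA; rewrite setTI.
pose G := [set B : set 'rV[R]_n | measurable (f @^-1` B)].
suff : rV_measurable `<=` G by apply.
apply: smallest_sub.
  split; rewrite /G /=.
  - by rewrite preimage_set0.
  - by move=> B mB; rewrite setTD preimage_setC; exact: measurableC.
  - by move=> F mF; rewrite preimage_bigcup; exact: bigcup_measurable.
move=> B; rewrite -bigcup_seq => -[i _ [Y mY <-]].
by rewrite /G /= setTI -[X in measurable X]setTI; exact: mf.
Qed.

Lemma measurable_dot n (f g : T -> 'rV[R]_n) : measurable_fun setT f ->
  measurable_fun setT g -> measurable_fun setT (fun t => dot (f t) (g t)).
Proof.
move=> mf mg; apply: measurable_sum => i; apply: measurable_funM.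
  exact: (measurableT_comp (measurable_coord i)).
exact: (measurableT_comp (measurable_coord i)).
Qed.

Lemma measurable_scale n (k : T -> R) (f : T -> 'rV[R]_n) : measurable_fun setT k ->
  measurable_fun setT f -> measurable_fun setT (fun t => k t *: f t).
Proof.
move=> mk mf; apply: measurable_fun_rV => i.
rewrite [X in measurable_fun _ X](_ : _ = (fun t => k t * f t 0 i)).
  by apply: measurable_funM => //; exact: (measurableT_comp (measurable_coord i)).
by apply/funext => t; rewrite mxE.
Qed.

Lemma measurable_row_mx n (k : T -> R) (f : T -> 'rV[R]_n) : measurable_fun setT k ->
  measurable_fun setT f ->
  measurable_fun setT (fun t => row_mx (k t)%:M (f t) : 'rV[R]_(1 + n)).
Proof.
move=> mk mf; apply: measurable_fun_rV => i.
case: (split_ordP i) => j ->.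
  rewrite [X in measurable_fun _ X](_ : _ = k)//.
  by apply/funext => t; rewrite row_mxEl mxE !ord1 eqxx.
rewrite [X in measurable_fun _ X](_ : _ = (fun t => f t 0 j)).
  exact: (measurableT_comp (measurable_coord j)).
by apply/funext => t; rewrite row_mxEr.
Qed.

End row_vector_measurability.

Section coordinate_maps.
Context {R : realType}.

Lemma measurable_lsubmx00 n : measurable_fun setT (fun x : 'rV[R]_(1 + n) => lsubmx x 0 0).
Proof.
rewrite [X in measurable_fun _ X](_ : _ = (fun x : 'rV[R]_(1 + n) => x 0 (lshift n 0))).
  exact: measurable_coord.
by apply/funext => x; rewrite mxE.
Qed.

Lemma measurable_rsubmx n : measurable_fun setT (fun x : 'rV[R]_(1 + n) => rsubmx x).
Proof.
apply: measurable_fun_rV => i.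
rewrite [X in measurable_fun _ X](_ : _ = (fun x : 'rV[R]_(1 + n) => x 0 (rshift 1 i))).
  exact: measurable_coord.
by apply/funext => x; rewrite mxE.
Qed.

Definition row_cons n (p : R * 'rV[R]_n) : 'rV[R]_(1 + n) := row_mx p.1%:M p.2.

Lemma measurable_row_cons n : measurable_fun setT (@row_cons n).
Proof. by apply: measurable_row_mx; [exact: measurable_fst|exact: measurable_snd]. Qed.

Lemma row_consK n (p : R * 'rV[R]_n) : (lsubmx (row_cons p) 0 0, rsubmx (row_cons p)) = p.
Proof. by case: p => a x; rewrite row_mxKl row_mxKr mxE eqxx. Qed.

Definition normalize n (x : 'rV[R]_n) : 'rV[R]_n := (Num.sqrt (dot x x))^-1 *: x.

Lemma measurable_normalize n : measurable_fun setT (@normalize n).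
Proof.
apply: measurable_scale; last exact: measurable_id.
rewrite [X in measurable_fun _ X](_ : _ = (fun x : 'rV[R]_n => dot x x `^ (- 2^-1))).
  apply: (measurableT_comp (measurable_powR _)).
  by apply: measurable_dot; exact: measurable_id.
by apply/funext => x; rewrite powRN powR12_sqrt// dot_ge0.
Qed.

End coordinate_maps.

Section lebesgue_rV_measure.
Context {R : realType}.

Section step.
Variables (n : nat) (mu : {sigma_finite_measure set 'rV[R]_n -> \bar R}).

(** One step of the recursion of [lebesgue_rV], taken over a bundled measure so that the measure and
    sigma-finiteness instances can be attached. *)
Definition row_cons_measure : set 'rV[R]_(1 + n) -> \bar R :=
  pushforward (@lebesgue_measure R \x mu)%E (@row_cons R n).

HB.instance Definition _ := Measure.copy row_cons_measure
  (measure_function_pushforward__canonical__measure_function_Measure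
     (@lebesgue_measure R \x mu)%E (@measurable_row_cons R n)).

Lemma row_cons_measure_sigma_finite : sigma_finite setT row_cons_measure.
Proof.
have /sigma_finiteP[F [TF ndF Foo]] := sigma_finiteT (@lebesgue_measure R).
have /sigma_finiteP[G [TG ndG Goo]] := sigma_finiteT mu.
pose g (x : 'rV[R]_(1 + n)) := (lsubmx x 0 0, rsubmx x).
have mg : measurable_fun setT g.
  by apply: measurable_fun_pair; [exact: measurable_lsubmx00|exact: measurable_rsubmx].
exists (fun i => g @^-1` (F i `*` G i)).
  apply/esym; rewrite -preimage_bigcup -subTset => x _.
  have [k _ Fk] : (\bigcup_i F i) (g x).1 by rewrite -TF.
  have [l _ Gl] : (\bigcup_i G i) (g x).2 by rewrite -TG.
  (* Both exhausting sequences are increasing, so the larger index serves both factors. *)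
  exists (maxn k l) => //; split.
    by move: Fk; exact/subsetPset/ndF/leq_maxl.
  by move: Gl; exact/subsetPset/ndG/leq_maxr.
move=> i; have [mF Fi] := Foo i; have [mG Gi] := Goo i; split.
  by rewrite -[X in measurable X]setTI; apply: mg => //; exact: measurableX.
rewrite /row_cons_measure /pushforward -comp_preimage (_ : _ \o _ = id); last first.
  by apply/funext => p; exact: row_consK.
by rewrite preimage_id product_measure1E// lte_mul_pinfty// ge0_fin_numE.
Qed.

HB.instance Definition _ := Measure_isSigmaFinite.Build _ _ _ row_cons_measure
  row_cons_measure_sigma_finite.

Definition row_cons_sigma_finite_measure : {sigma_finite_measure set 'rV[R]_(1 + n) -> \bar R} :=
  row_cons_measure.
End step.

Lemma lebesgue_rVP n : exists mu : {sigma_finite_measure set 'rV[R]_n -> \bar R},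
  @lebesgue_rV R n = mu.
Proof.
elim: n => [|n [mu IH]]; first by exists \d_(0 : 'rV[R]_0).
exists (row_cons_sigma_finite_measure mu).
by rewrite /= IH.
Qed.

End lebesgue_rV_measure.

Section boxes.
Context {R : realType}.

Definition box n (c : 'rV[R]_n) (h : R) : set 'rV[R]_n :=
  [set x | forall i, `|x 0 i - c 0 i| < h].

Lemma measurable_box n (c : 'rV[R]_n) h : measurable (box c h).
Proof.
rewrite (_ : box c h = \bigcap_(i in [set: 'I_n])
    ((fun x : 'rV[R]_n => x 0 i) @^-1` ball (c 0 i) h)).
  apply: fin_bigcap_measurable => // i _; rewrite -[X in measurable X]setTI.
  by apply: measurable_coord => //; exact: measurable_ball.
apply/seteqP; split=> [x xb i _|x xb i]; first by rewrite /= /ball/= distrC; exact: xb.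
by have := xb i I; rewrite /= /ball/= distrC.
Qed.

Lemma lebesgue_rV_box n (c : 'rV[R]_n) h : 0 <= h ->
  lebesgue_rV (box c h) = ((h *+ 2) ^+ n)%:E.
Proof.
move=> h0; elim: n c => [|n IH] c.
  by rewrite /= diracE mem_set// => -[].
have [mu E] := @lebesgue_rVP R n.
pose c' : 'rV[R]_(1 + n) := c.
rewrite [LHS]/= /pushforward.
rewrite (_ : _ @^-1` _ = `]lsubmx c' 0 0 - h, lsubmx c' 0 0 + h[%classic `*` box (rsubmx c') h).
  rewrite E product_measure1E//; last exact: measurable_box.
  rewrite -E IH [X in (X * _)%E](lebesgue_measure_itv `]_, _[)/= lte_fin.
  case: ifPn => hh; last first.
    have -> : h = 0 by move: hh; lra.
    by rewrite mul0e mul0rn expr0n.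
  rewrite -EFinB -EFinM exprS; congr (_ * _)%:E.
  by rewrite mulr2n; lra.
apply/seteqP; split=> -[a x] /=.
  move=> H0.
  have H : forall i : 'I_(1 + n), `|(row_mx a%:M x : 'rV_(1 + n)) 0 i - c' 0 i| < h := H0.
  split=> [|i].
    have := H (lshift n (0 : 'I_1)).
    by rewrite row_mxEl !mxE eqxx in_itv/= ltr_norml; lra.
  by have := H (rshift 1 i); rewrite row_mxEr mxE.
move=> [H1 H2].
suff : forall i : 'I_(1 + n), `|(row_mx a%:M x : 'rV_(1 + n)) 0 i - c' 0 i| < h by [].
move=> i; case: (split_ordP i) => j ->.
  rewrite row_mxEl !mxE ord1 eqxx; move: H1; rewrite in_itv/= mxE ltr_norml.
  by lra.
by rewrite row_mxEr; have := H2 j; rewrite mxE.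
Qed.

End boxes.

(** * Surface measure of the sphere as a finite measure *)

Section sphere_measure_theory.
Context {R : realType} (n : nat).

Lemma measurable_shell : measurable [set x : 'rV[R]_n | 0 < dot x x <= 1].
Proof.
have md : measurable_fun setT (fun x : 'rV[R]_n => dot x x).
  by apply: measurable_dot; exact: measurable_id.
rewrite (_ : [set _ | _] = setT `&` (fun x : 'rV[R]_n => dot x x) @^-1` `]0, 1]%classic).
  exact: md.
by rewrite setTI; apply/seteqP; split => x /=; rewrite in_itv.
Qed.

Section construction.
Variable mu : {sigma_finite_measure set 'rV[R]_n -> \bar R}.
Hypothesis muE : @lebesgue_rV R n = mu.

(** The cone formula read as a composite of measure operations: restriction to the punctured unit
    ball, then image under radial projection. *)
Let cone : set 'rV[R]_n -> \bar R :=
  pushforward (mrestr mu measurable_shell) (@normalize R n).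

HB.instance Definition _ := Measure.copy cone
  (measure_function_pushforward__canonical__measure_function_Measure
     (mrestr mu measurable_shell) (@measurable_normalize R n)).

Definition cone_measure : set 'rV[R]_n -> \bar R := mscale n%:R%:nng cone.

HB.instance Definition _ := Measure.on cone_measure.

Lemma cone_measureE : cone_measure = @sphere_measure R n.
Proof.
apply/funext => A; rewrite /cone_measure /mscale /= /sphere_measure muE; congr (_ * mu _)%E.
by rewrite setIC.
Qed.

Lemma cone_measure_fin : fin_num_fun cone_measure.
Proof.
apply: lty_fin_num_fun.
rewrite /cone_measure /mscale /= /cone /pushforward /mrestr.
rewrite lte_mul_pinfty ?lee_fin//.
apply: (@le_lt_trans _ _ (mu (box 0 2))).
  apply: le_measure.
  - by rewrite inE preimage_setT setTI; exact: measurable_shell.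
  - by rewrite inE; exact: measurable_box.
  move=> x [_ /= /andP[_ x1]] i; rewrite mxE subr0.
  have : x 0 i ^+ 2 <= dot x x.
    by rewrite /dot (bigD1 i)//= -expr2 lerDl sumr_ge0// => j _; rewrite -expr2 sqr_ge0.
  by rewrite ltr_norml; nra.
by rewrite -muE lebesgue_rV_box ?ltry.
Qed.

HB.instance Definition _ := Measure_isFinite.Build _ _ _ cone_measure cone_measure_fin.

Definition cone_finite_measure : {finite_measure set 'rV[R]_n -> \bar R} := cone_measure.

End construction.

Lemma sphere_measureP :
  exists sg : {finite_measure set 'rV[R]_n -> \bar R}, @sphere_measure R n = sg.
Proof.
have [mu muE] := @lebesgue_rVP R n.
by exists (cone_finite_measure muE); rewrite -(cone_measureE muE).
Qed.

End sphere_measure_theory.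

(** * Measure of spherical caps *)

Section cap_measure.
Context {R : realType} {n : nat}.
Implicit Types (x w z : 'rV[R]_n) (s t h : R).

Lemma dot_normalize x : 0 < dot x x -> dot (normalize x) (normalize x) = 1.
Proof.
move=> x0; rewrite dotZl dotZr mulrA -invfM -expr2 sqr_sqrtr ?dot_ge0//.
by rewrite mulVf// lt0r_neq0.
Qed.

(** Otherwise each square is below 1/n and they cannot sum to 1. The large coordinate is where boxes
    along the axis [w] get separated. *)
Lemma unit_vector_large_coord w : dot w w = 1 -> exists i, n%:R^-1 <= `|w 0 i|.
Proof.
move=> w1; apply: contrapT => /forallNP H.
have n0 : (0 < n)%N.
  by case: n w w1 H => // w; rewrite /dot big_ord0 => /esym/eqP; rewrite oner_eq0.
have n0R : 0 < n%:R :> R by rewrite ltr0n.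
have wi i : w 0 i * w 0 i < n%:R^-1.
  have := H i => /negP; rewrite -ltNge => lt.
  have n1 : n%:R^-1 <= 1 :> R by rewrite invf_le1// ler1n.
  rewrite -expr2 -real_normK ?num_real// expr2.
  by have := normr_ge0 (w 0 i); nra.
have : \sum_(i < n) w 0 i * w 0 i < \sum_(i < n) n%:R^-1.
  apply: ltr_sum => //.
  by apply/hasP; exists (Ordinal n0) => //; rewrite mem_index_enum.
by rewrite [ltLHS]w1 sumr_const card_ord -[n%:R^-1 *+ n]mulr_natr mulVf ?ltxx// lt0r_neq0.
Qed.

Lemma dot_box_le z h : box 0 h z -> dot z z <= n%:R * h ^+ 2.
Proof.
move=> zb; rewrite mulr_natl -{2}(card_ord n) -sumr_const; apply: ler_sum => i _.
have := zb i; rewrite mxE subr0 -expr2 => lt.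
by rewrite -real_normK ?num_real//; have := normr_ge0 (z 0 i); nra.
Qed.

(** Write [x = t *: w + z]. The half-side makes [z] of length at most [1 / (8 N)], so the component
    along [w] is at least 1/2 - 1/8 = 3/8, whereas [sinh s] times the distance to the axis is at
    most 1/8; the norm is at most 3/4 + 1/8. *)
Lemma cap_contains_box w s t (N : R) (A : set 'rV[R]_n) :
  dot w w = 1 -> (0 < n)%N -> cosh s <= N -> 1 / 2 <= t <= 3 / 4 ->
  (forall v, dot v v = 1 -> tanh s < dot v w -> A v) ->
  forall x, box (t *: w) (8 * n%:R * N)^-1 x ->
    0 < dot x x <= 1 /\ A (normalize x).
Proof.
move=> w1 n0 sN /andP[t1 t2] HA x xb.
have n1 : 1 <= n%:R :> R by rewrite ler1n.
have c1 := cosh_ge1 s; have cs := cosh2Bsinh2 s.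
have N1 : 1 <= N by exact: le_trans sN.
have [z zb xE] : exists2 z, box 0 (8 * n%:R * N)^-1 z & x = t *: w + z.
  exists (x - t *: w); last by rewrite addrC subrK.
  by move=> i; have := xb i; rewrite !mxE subr0.
have zz : dot z z <= (8 * N)^-1 ^+ 2.
  apply: (@le_trans _ _ (n%:R * (8 * n%:R * N)^-1 ^+ 2)).
    exact: dot_box_le.
  rewrite -subr_ge0.
  have -> : (8 * N)^-1 ^+ 2 - n%:R * (8 * n%:R * N)^-1 ^+ 2 =
    (8 * N)^-1 ^+ 2 * (1 - n%:R^-1).
    by field; apply/andP; split; lra.
  by rewrite mulr_ge0 ?sqr_ge0// subr_ge0 invf_le1//; lra.
have k0 : 0 < (8 * N)^-1 by rewrite invr_gt0; lra.
have kN : (8 * N)^-1 * N = 1 / 8 by field; lra.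
set k := (8 * N)^-1 in zz k0 kN.
have k8 : k <= 1 / 8 by nra.
pose p := dot z w.
have p2 : p ^+ 2 <= dot z z by have := Cauchy_Schwarz_dot z w; rewrite w1 mulr1.
have xw : dot x w = t + p by rewrite xE dotDl dotZl w1 mulr1.
have xx : dot x x = t ^+ 2 + 2 * t * p + dot z z.
  by rewrite xE !dotE w1 (dotC w z) -/p; ring.
have pk : - k <= p <= k.
  rewrite -ler_norml -(@ler_pXn2r _ 2) ?nnegrE ?normr_ge0 ?(ltW k0)//.
  by rewrite real_normK ?num_real//; lra.
case/andP: pk => pk1 pk2.
have xw0 : 3 / 8 <= dot x w by lra.
have xx1 : dot x x <= 1.
  rewrite xx; have : t ^+ 2 <= 9 / 16 by nra.
  have : 2 * t * p <= 3 / 2 * (1 / 8) by nra.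
  have : dot z z <= 1 / 64 by nra.
  by lra.
have xx0 : 0 < dot x x.
  by have := Cauchy_Schwarz_dot x w; rewrite w1 mulr1; nra.
rewrite xx0 xx1; split=> //; apply: HA; first exact: dot_normalize.
have q0 : 0 < Num.sqrt (dot x x) by rewrite sqrtr_gt0.
have q2 : Num.sqrt (dot x x) ^+ 2 = dot x x by rewrite sqr_sqrtr// ltW.
rewrite dotZl mulrC ltr_pdivlMr// /tanh mulrAC ltr_pdivrMr ?cosh_gt0//.
set q := Num.sqrt _ in q0 q2 *.
(* The cap condition in tangent form, squared: [sinh s] times the distance from [x] to the axis is
   less than the component along the axis. *)
have S : sinh s ^+ 2 * (dot x x - dot x w ^+ 2) < dot x w ^+ 2.
  have -> : dot x x - dot x w ^+ 2 = dot z z - p ^+ 2 by rewrite xx xw; ring.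
  have s2 : sinh s ^+ 2 <= N ^+ 2.
    apply: (@le_trans _ _ (cosh s ^+ 2)); first by lra.
    by rewrite ler_pXn2r ?nnegrE//; lra.
  have d1 : dot z z - p ^+ 2 <= k ^+ 2 by have := sqr_ge0 p; lra.
  have : sinh s ^+ 2 * (dot z z - p ^+ 2) <= N ^+ 2 * k ^+ 2.
    by rewrite ler_pM ?sqr_ge0// subr_ge0.
  have -> : N ^+ 2 * k ^+ 2 = (1 / 8) ^+ 2 by rewrite -exprMn mulrC kN.
  have : (3 / 8) ^+ 2 <= dot x w ^+ 2 by rewrite ler_pXn2r ?nnegrE//; lra.
  by lra.
have S' : (sinh s * q) ^+ 2 < (dot x w * cosh s) ^+ 2.
  have -> : (sinh s * q) ^+ 2 = sinh s ^+ 2 * dot x x by rewrite -q2; ring.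
  have -> : (dot x w * cosh s) ^+ 2 = dot x w ^+ 2 * (1 + sinh s ^+ 2).
    by rewrite (_ : 1 + sinh s ^+ 2 = cosh s ^+ 2); [ring|lra].
  by lra.
have D0 : 0 < dot x w * cosh s by apply: mulr_gt0; lra.
move: (sinh s * q) (dot x w * cosh s) S' D0 => X Y XY Y0.
by rewrite ltNge; apply/negP => YX; nra.
Qed.

(** In a coordinate where [w] is at least 1/n in absolute value, two centres differ by at least
    [1 / (4 n N)], which is exactly the side of the open boxes. *)
Lemma separated_boxes_disjoint w (N : nat) : dot w w = 1 -> (0 < n)%N -> (0 < N)%N ->
  trivIset [set: 'I_N]
    (fun k : 'I_N => box ((1 / 2 + k%:R / (4 * N%:R)) *: w) (8 * n%:R * N%:R)^-1).
Proof.
move=> w1 n0 N0 k l _ _ [x [xk xl]].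
have [i wi] := unit_vector_large_coord w1.
have n0R : 0 < n%:R :> R by rewrite ltr0n.
have N0R : 0 < N%:R :> R by rewrite ltr0n.
apply: contrapT => /eqP kl.
have kl1 : 1 <= `|k%:R - l%:R : R|.
  wlog lk : k l xk xl kl / (l < k)%N.
    move=> H; have := kl; rewrite -val_eqE neq_ltn => /orP[|]; last exact: H.
    by rewrite distrC; apply: H => //; rewrite eq_sym.
  by rewrite ger0_norm ?subr_ge0 ?ler_nat ?(ltnW lk)// -natrB ?(ltnW lk)// ler1n subn_gt0.
have := xk i; have := xl i; rewrite !mxE => hl hk.
have : `|(k%:R - l%:R) / (4 * N%:R) * w 0 i| < (8 * n%:R * N%:R)^-1 *+ 2.
  rewrite mulr2n; apply: le_lt_trans (ltrD hl hk).
  rewrite -[X in _ <= _ + X]normrN; apply: le_trans (ler_normD _ _).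
  by rewrite le_eqVlt; apply/orP; left; apply/eqP; congr `|_|; field; lra.
have i0 : 0 <= (4 * N%:R)^-1 :> R by rewrite invr_ge0; lra.
apply/negP; rewrite -leNgt !normrM (ger0_norm i0).
have -> : (8 * n%:R * N%:R)^-1 *+ 2 = (4 * N%:R)^-1 * n%:R^-1 :> R.
  by rewrite mulr2n; field; apply/andP; split; lra.
rewrite -mulrA; apply: (@le_trans _ _ (1 * ((4 * N%:R)^-1 * n%:R^-1))); first by rewrite mul1r.
by rewrite ler_pM ?mulr_ge0 ?invr_ge0 ?ler_wpM2l// ltW.
Qed.

(* The cap at distance [s] has angular radius about [1 / cosh s], and the cone
   over it contains about [cosh s] disjoint boxes of side about [1 / cosh s]
   along its axis. *)
Lemma sphere_measure_cap w : dot w w = 1 -> exists2 c : R, 0 < c &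
  forall s (A : set 'rV[R]_n), measurable A ->
    (forall v, dot v v = 1 -> tanh s < dot v w -> A v) ->
    ((c / cosh s ^+ n.-1)%:E <= sphere_measure A)%E.
Proof.
move=> w1.
have n0 : (0 < n)%N.
  by have [i _] := unit_vector_large_coord w1; exact: leq_ltn_trans (ltn_ord i).
have n0R : 0 < n%:R :> R by rewrite ltr0n.
(* [N] boxes of side [1 / (4 n N)] have total volume [(4 n)^-n N^(1-n)]; the power of 1/2 comes from
   [N <= 2 cosh s] and the factor [n] from the cone formula. *)
exists (n%:R * ((4 * n%:R)^-1 ^+ n * 2^-1 ^+ n.-1)).
  by rewrite !mulr_gt0 ?exprn_gt0 ?invr_gt0//; lra.
move=> s A mA HA; have c1 := cosh_ge1 s.
have [mu muE] := @lebesgue_rVP R n.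
have muB x h : 0 <= h -> mu (box x h) = ((h *+ 2) ^+ n)%:E.
  by move=> h0; rewrite -muE lebesgue_rV_box.
(* An integer above [cosh s], yet at most [2 * cosh s] because [cosh s >= 1]. *)
pose N := (Num.truncn (cosh s)).+1.
have /andP[tr1 tr2] := @truncn_itv _ (cosh s) (ltW (cosh_gt0 s)).
have N2 : N%:R <= 2 * cosh s by rewrite /N -addn1 natrD; lra.
have N0R : 0 < N%:R :> R by rewrite ltr0n.
pose F (k : 'I_N) := box ((1 / 2 + k%:R / (4 * N%:R)) *: w) (8 * n%:R * N%:R)^-1.
rewrite /sphere_measure muE -mulrA EFinM lee_pmul2l// ?lte_fin//.
apply: (@le_trans _ _ (mu (\big[setU/set0]_(k < N) F k))); last first.
  apply: le_measure; rewrite ?inE.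
  - by apply: bigsetU_measurable => k _; exact: measurable_box.
  - rewrite (_ : [set _ | _] = [set x | 0 < dot x x <= 1] `&` (@normalize R n @^-1` A)).
      apply: measurableI; first exact: measurable_shell.
      by rewrite -[X in measurable X]setTI; exact: measurable_normalize.
    by apply/seteqP; split=> x [].
  - rewrite -bigcup_seq => x [k _ xk].
    apply: (cap_contains_box w1 n0 (ltW tr2) _ HA xk).
    have : 0 <= (k%:R / (4 * N%:R) : R) < 1 / 4.
      apply/andP; split; first by apply: divr_ge0; [exact: ler0n|lra].
      rewrite ltr_pdivrMr; last by lra.
      have : k%:R < N%:R :> R by rewrite ltr_nat.
      by lra.
    by lra.
rewrite measure_bigsetU_ord; last 2 first.
  by move=> k; exact: measurable_box.
  exact: separated_boxes_disjoint.
rewrite (eq_bigr (fun=> ((4 * n%:R * N%:R)^-1 ^+ n)%:E)); last first.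
  move=> k _; rewrite [LHS]muB; last by rewrite invr_ge0 !mulr_ge0.
  by congr ((_ ^+ _)%:E); rewrite mulr2n; field; apply/andP; split; lra.
rewrite sumEFin sumr_const card_ord lee_fin.
have -> : (4 * n%:R * N%:R)^-1 ^+ n *+ N = (4 * n%:R)^-1 ^+ n * N%:R^-1 ^+ n.-1 :> R.
  rewrite -[LHS]mulr_natr invfM exprMn -mulrA; congr (_ * _).
  by rewrite -[X in _ ^+ X * _](prednK n0) exprSr -mulrA mulVf ?mulr1// lt0r_neq0.
rewrite -mulrA ler_pM2l ?exprn_gt0 ?invr_gt0 ?mulr_gt0//.
rewrite -exprVn -exprMn lerXn2r ?nnegrE ?mulr_ge0 ?invr_ge0 ?(ltW (cosh_gt0 s))//.
by rewrite -invfM lef_pV2 ?posrE//; have := cosh_gt0 s; lra.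
Qed.

End cap_measure.

(** * The measure on de Sitter space *)

Section dS_measure_theory.
Context {R : realType} {n : nat}.
Local Notation V := 'rV[R]_(1 + n).
Implicit Types (A : set V) (s b c B : R) (w : 'rV[R]_n).

Lemma measurable_cosh : measurable_fun setT (@cosh R).
Proof.
apply: measurable_funM; last exact: measurable_cst.
apply: measurable_funD; first exact: measurable_expR.
by apply: measurableT_comp; [exact: measurable_expR|exact: oppr_measurable].
Qed.

Lemma measurable_sinh : measurable_fun setT (@sinh R).
Proof.
apply: measurable_funM; last exact: measurable_cst.
apply: measurable_funB; first exact: measurable_expR.
by apply: measurableT_comp; [exact: measurable_expR|exact: oppr_measurable].
Qed.

Lemma measurable_dS_param :
  measurable_fun setT (fun p : R * 'rV[R]_n => dS_param p.1 p.2).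
Proof.
apply: measurable_row_mx.
  by apply: measurableT_comp; [exact: measurable_sinh|exact: measurable_fst].
apply: measurable_scale; last exact: measurable_snd.
by apply: measurableT_comp; [exact: measurable_cosh|exact: measurable_fst].
Qed.

Definition dS_domain A : set (R * 'rV[R]_n) := [set p | A (dS_param p.1 p.2)].

Lemma measurable_dS_domain A : measurable A -> measurable (dS_domain A).
Proof.
by move=> mA; rewrite -[X in measurable X]setTI; exact: measurable_dS_param.
Qed.

Definition dS_slice A s : set 'rV[R]_n := [set w | A (dS_param s w)].

Lemma measurable_dS_slice A s : measurable A -> measurable (dS_slice A s).
Proof.
move=> mA; rewrite (_ : dS_slice A s = xsection (dS_domain A) s).
  by apply: measurable_xsection; exact: measurable_dS_domain.
by apply/seteqP; split => w; rewrite xsectionP.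
Qed.

Definition density (p : R * 'rV[R]_n) : \bar R := (cosh p.1 ^+ n.-1)%:E.

Lemma measurable_density A : measurable A ->
  measurable_fun setT (density \_ (dS_domain A)).
Proof.
move=> mA; apply/(measurable_restrictT _ (measurable_dS_domain mA)).
apply: measurable_funTS; apply/measurable_EFinP; apply: measurable_funX.
by apply: measurableT_comp; [exact: measurable_cosh|exact: measurable_fst].
Qed.

Lemma density_ge0 A p : (0 <= (density \_ (dS_domain A)) p)%E.
Proof. by apply: erestrict_ge0 => q _; rewrite lee_fin exprn_ge0// ltW// cosh_gt0. Qed.

Lemma dS_integral_mkcond (mu : {finite_measure set 'rV[R]_n -> \bar R}) A :
  (\int[@lebesgue_measure R \x mu]_(p in [set p | A (dS_param p.1 p.2)])
    (cosh p.1 ^+ n.-1)%R%:E =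
  \int[@lebesgue_measure R \x mu]_p (density \_ (dS_domain A)) p)%E.
Proof. apply: integral_mkcond. Qed.

Lemma dS_measureE A : measurable A -> dS_measure A =
  (\int[@lebesgue_measure R]_s ((cosh s ^+ n.-1)%:E * sphere_measure (dS_slice A s)))%E.
Proof.
move=> mA; have [sg sgE] := @sphere_measureP R n.
rewrite /dS_measure sgE dS_integral_mkcond.
apply: (etrans (@fubini_tonelli1 _ _ _ _ _ (@lebesgue_measure R) sg
  (density \_ (dS_domain A)) (measurable_density mA) (density_ge0 A))).
apply: eq_integral => s _; rewrite /fubini_F.
transitivity (\int[sg]_w ((cst (cosh s ^+ n.-1)%:E) \_ (dS_slice A s)) w)%E.
  by apply: eq_integral => w _; rewrite !patchE.
by rewrite -integral_mkcond (integral_cst sg (measurable_dS_slice s mA)).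
Qed.

(** Used twice: on a half-line to get infinite measure, and on a short interval to separate two
    borders. *)
Lemma dS_measure_ge A (I : set R) c : measurable A -> measurable I -> 0 <= c ->
  (forall s, I s -> (c%:E <= (cosh s ^+ n.-1)%:E * sphere_measure (dS_slice A s))%E) ->
  (c%:E * lebesgue_measure I <= dS_measure A)%E.
Proof.
move=> mA mI c0 H; have [sg sgE] := @sphere_measureP R n.
rewrite dS_measureE// -(integral_cst (@lebesgue_measure R) mI).
apply: (@le_trans _ _ (\int[@lebesgue_measure R]_s ((cst c%:E) \_ I) s)%E).
  by rewrite -integral_mkcond.
apply: ge0_le_integral => //.
- by move=> s _; apply: erestrict_ge0 => t _; rewrite lee_fin.
- by apply/(measurable_restrictT _ mI); exact: measurable_cst.
- rewrite sgE; apply: emeasurable_funM.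
    by apply/measurable_EFinP; apply: measurable_funX; exact: measurable_cosh.
  rewrite (_ : (fun _ => _) = sg \o xsection (dS_domain A)).
    by apply: measurable_fun_xsection; rewrite ?inE; exact: measurable_dS_domain.
  by apply/funext => s /=; congr (sg _); apply/seteqP; split => w; rewrite xsectionP.
move=> s _; rewrite patchE; case: ifPn => [/set_mem/H//|_].
by rewrite sgE mule_ge0// lee_fin exprn_ge0// ltW// cosh_gt0.
Qed.

Lemma dS_measure_slab_lty A B : measurable A ->
  (forall s w, A (dS_param s w) -> - B <= s <= B) -> (dS_measure A < +oo)%E.
Proof.
move=> mA H; have [sg sgE] := @sphere_measureP R n.
rewrite dS_measureE//.
pose K : \bar R := ((cosh B ^+ n.-1)%:E * sg setT)%E.
have K0 : (0 <= K)%E by rewrite mule_ge0// lee_fin exprn_ge0// ltW// cosh_gt0.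
pose I : set R := `[- B, B]%classic.
have mI : measurable I by exact: measurable_itv.
have le_slab : (\int[@lebesgue_measure R]_s ((cosh s ^+ n.-1)%:E * sphere_measure (dS_slice A s))
    <= \int[@lebesgue_measure R]_(s in I) cst K s)%E.
  apply: (@le_trans _ _ (\int[@lebesgue_measure R]_s ((cst K) \_ I) s)%E); last first.
    by rewrite -integral_mkcond.
  apply: ge0_le_integral => //.
  - by move=> s _; rewrite sgE mule_ge0// lee_fin exprn_ge0// ltW// cosh_gt0.
  - rewrite sgE; apply: emeasurable_funM.
      by apply/measurable_EFinP; apply: measurable_funX; exact: measurable_cosh.
    rewrite (_ : (fun _ => _) = sg \o xsection (dS_domain A)).
      by apply: measurable_fun_xsection; rewrite ?inE; exact: measurable_dS_domain.
    by apply/funext => s /=; congr (sg _); apply/seteqP; split => w; rewrite xsectionP.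
  - by apply/(measurable_restrictT _ mI); exact: measurable_cst.
  move=> s _; rewrite patchE; case: ifPn => [/set_mem|].
    rewrite /I/= in_itv/= => sB; rewrite sgE; apply: lee_pmul => //.
    + by rewrite lee_fin exprn_ge0// ltW// cosh_gt0.
    + rewrite lee_fin lerXn2r ?nnegrE ?(ltW (cosh_gt0 _))//.
      have c1 := cosh2Bsinh2 s; have c2 := cosh2Bsinh2 B.
      rewrite -(@ler_pXn2r _ 2) ?nnegrE ?(ltW (cosh_gt0 _))//.
      (* The bound on the even function [cosh] is drawn from the monotone [sinh], the two squares
         differing by 1. *)
      have : `|sinh s| <= sinh B.
        have mono (x y : R) : x <= y -> sinh x <= sinh y.
          by move=> xy; rewrite /sinh ler_pM2r// lerB ?ler_expR// lerN2.
        by case/andP: sB => s1 s2; rewrite ler_norml -sinhN !mono.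
      move=> ss; have B0 := le_trans (normr_ge0 _) ss.
      by move: ss; rewrite -(@ler_pXn2r _ 2 isT `|_|) ?nnegrE// real_normK ?num_real//; lra.
    + by apply: le_measure; rewrite ?inE//; exact: measurable_dS_slice.
  move=> nI; rewrite (_ : dS_slice A s = set0) ?sgE ?measure0 ?mule0//.
  rewrite -subset0 => w /H sB; move/negP: nI; apply; rewrite inE /I/= in_itv/=.
  exact: sB.
apply: (le_lt_trans le_slab); rewrite integral_cst// lte_mul_pinfty//.
  by rewrite fin_numM// fin_num_measure.
by rewrite [ltLHS]lebesgue_measure_itv/=; case: ifP => _; rewrite ?ltry// -EFinB ltry.
Qed.

(** Tonelli in the order opposite to [dS_measureE]: for a fixed direction the parameters fill at
    most one point. *)
Lemma dS_measure_graph0 A (b : 'rV[R]_n -> R) : measurable A ->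
  (forall s w, A (dS_param s w) -> s = b w) -> dS_measure A = 0%E.
Proof.
move=> mA H; have [sg sgE] := @sphere_measureP R n.
rewrite /dS_measure sgE dS_integral_mkcond.
apply: (etrans (@fubini_tonelli2 _ _ _ _ _ (@lebesgue_measure R) sg
  (density \_ (dS_domain A)) (measurable_density mA) (density_ge0 A))).
apply: integral0_eq => w _; rewrite /fubini_G.
transitivity (\int[@lebesgue_measure R]_s
    ((fun s => (cosh s ^+ n.-1)%:E) \_ [set s | A (dS_param s w)]) s)%E.
  by apply: eq_integral => s _; rewrite !patchE.
by rewrite -integral_mkcond; apply: (integral_Sset1 (b w)) => s /= /H.
Qed.

End dS_measure_theory.

(** * Border of a finite section *)

Section borders.
Context {R : realType} {n : nat}.
Local Notation V := 'rV[R]_(1 + n).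
Implicit Types (tau A : set V) (r s b : R) (v w : 'rV[R]_n).

Lemma base_point_section s v :
  point_section base_point (dS_param s v) <-> dot v v = 1 /\ s < 0.
Proof.
have l : lorentz base_point (dS_param s v) = - sinh s.
  rewrite /lorentz /base_point lsub_dS_param row_mxKl row_mxKr mxE eqxx mul1r.
  by rewrite -(scale0r (rsubmx (dS_param s v))) dotZl mul0r addr0.
have s0 : (0 < - sinh s) = (s < 0).
  rewrite oppr_gt0 /sinh pmulr_llt0 ?invr_gt0// subr_lt0 ltr_expR.
  by apply/idP/idP => h; lra.
split=> [[/dS_dS_param v1 h]|[v1 sn]].
  by split=> //; rewrite -s0 -l.
by split; [apply/dS_dS_param|rewrite /= l s0].
Qed.

Lemma measurable_lorentz d (T : measurableType d) (f g : T -> V) :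
  measurable_fun setT f -> measurable_fun setT g ->
  measurable_fun setT (fun t => lorentz (f t) (g t)).
Proof.
move=> mf mg; apply: measurable_funD.
  apply: measurableT_comp; first exact: oppr_measurable.
  apply: measurable_funM.
    exact: (measurableT_comp (measurable_lsubmx00 (n := n)) mf).
  exact: (measurableT_comp (measurable_lsubmx00 (n := n)) mg).
apply: measurable_dot.
  exact: (measurableT_comp (measurable_rsubmx (n := n)) mf).
exact: (measurableT_comp (measurable_rsubmx (n := n)) mg).
Qed.

Lemma measurable_dS : measurable (@dS R n).
Proof.
rewrite (_ : @dS R n = setT `&` (fun u => lorentz u u) @^-1` [set 1]).
  by apply: measurable_lorentz => //; exact: measurable_id.
by rewrite setTI.
Qed.

Lemma measurable_point_section (x : V) : measurable (point_section x).
Proof.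
apply: measurableI; first exact: measurable_dS.
rewrite (_ : [set _ | _] = setT `&` (fun u => lorentz x u) @^-1` `]0, +oo[%classic).
  apply: measurable_lorentz => //; exact: measurable_cst.
by rewrite setTI; apply/seteqP; split => u /=; rewrite in_itv/= andbT.
Qed.

Lemma measurable_setY d (T : measurableType d) (A B : set T) :
  measurable A -> measurable B -> measurable (A `+` B).
Proof. by move=> mA mB; apply: measurableU; exact: measurableD. Qed.

Lemma cap_sphere_dist s v w : dot v v = 1 -> dot w w = 1 ->
  tanh s < dot v w -> sphere_dist v w < pi / 2 - gd s.
Proof.
move=> v1 w1; rewrite -cos_sphere_dist// -sin_gd -cosBpihalf -cosN opprB.
have /andP[g1 g2] := gd_bound s; have pi0 := pi_gt0 R.
by rewrite ltr_cos// in_itv/= ?sphere_dist_itv//; apply/andP; split; lra.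
Qed.

(* The density [cosh s ^+ n.-1] compensates the size of the caps, so every
   [s > 0] contributes at least a fixed amount. *)
Lemma dS_measure_cone_infty A w : measurable A -> dot w w = 1 ->
  (forall s v, 0 < s -> dot v v = 1 -> tanh s < dot v w -> A (dS_param s v)) ->
  dS_measure A = +oo%E.
Proof.
move=> mA w1 HA; have [c c0 Hc] := sphere_measure_cap w1.
apply/eqP; rewrite -leye_eq.
have <- : (c%:E * @lebesgue_measure R `]0%R, +oo[ = +oo)%E.
  by rewrite lebesgue_measure_itv/= ltry gt0_muley// lte_fin.
apply: dS_measure_ge => //; first exact: ltW.
move=> s /=; rewrite in_itv/= andbT => s0.
have k0 : 0 < cosh s ^+ n.-1 by rewrite exprn_gt0// cosh_gt0.
have := Hc s (dS_slice A s) (measurable_dS_slice s mA) (fun v hv => HA s v s0 hv).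
move=> h; apply: le_trans (lee_wpmul2l _ h); last by rewrite lee_fin ltW.
by rewrite -EFinM lee_fin mulrC divfK// lt0r_neq0.
Qed.

Lemma cap_le_exists s v w : dot v v = 1 -> dot w w = 1 -> tanh s < dot v w ->
  exists r, gd s < gd r - sphere_dist w v.
Proof.
move=> v1 w1 /(cap_sphere_dist v1 w1); rewrite (sphere_dist_sym v) => h.
have /andP[d0 _] := sphere_dist_itv w1 v1; have /andP[g1 g2] := gd_bound s.
(* The angle is halfway between [gd s + d] and pi/2, where [d] is the distance from [w] to [v]; the
   cap hypothesis makes this interval nonempty. *)
have [|r rE] := @gd_surj R ((gd s + sphere_dist w v + pi / 2) / 2).
  by apply/andP; split; lra.
by exists r; rewrite rE; lra.
Qed.

Lemma cap_leW a b v w : a < b - sphere_dist w v -> cap_le b w a v.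
Proof. by move=> /ltW. Qed.

Section finite_section.
Variable tau : set V.
Hypothesis fin : finite_sections tau.

Lemma finite_section_antipode r v : dot v v = 1 ->
  tau (dS_param r v) -> ~ tau (dS_param (- r) (- v)).
Proof. by case: fin => _ _ /admissibleP[F3 _] _; exact: F3. Qed.

(** The strict inequality rules out equal parameters, which discharges the side condition in
    [admissibleP]. *)
Lemma finite_section_closed r v s w : dot v v = 1 -> dot w w = 1 ->
  ~ tau (dS_param (- r) (- v)) -> gd s < gd r - sphere_dist v w ->
  tau (dS_param s w).
Proof.
move=> v1 w1 t h; case: fin => _ _ /admissibleP[_ F2] _.
apply: (F2 r v) => //; first exact: cap_leW.
by move=> [E1 E2]; move: h; rewrite E1 E2 sphere_distxx// subr0 ltxx.
Qed.

Lemma finite_section_open r v s w : dot v v = 1 -> dot w w = 1 ->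
  tau (dS_param r v) -> gd s < gd r - sphere_dist v w -> tau (dS_param s w).
Proof.
by move=> v1 w1 /(finite_section_antipode v1) t; exact: finite_section_closed.
Qed.

Lemma finite_section_not_all w : dot w w = 1 ->
  ~ (forall r, ~ tau (dS_param (- r) (- w))).
Proof.
move=> w1 H; case: (fin) => td mt adm.
rewrite (@dS_measure_cone_infty _ w)//.
  by apply: measurable_setY => //; exact: measurable_point_section.
move=> s v s0 v1 /(cap_le_exists v1 w1)[r hr]; left; split.
  by apply: (finite_section_closed w1 v1 (H r)).
by move=> /base_point_section[_]; lra.
Qed.

Lemma exists_is_border w : dot w w = 1 -> exists b, is_border tau w b.
Proof.
move=> w1; pose S := [set r | tau (dS_param r w)].
have down r s : S r -> s < r -> S s.
  move=> Sr sr; apply: (finite_section_open w1 w1 Sr).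
  by rewrite sphere_distxx// subr0 gd_mono.
(* An empty line in direction [w] is a line in direction [- w] on which all closed sides are chosen,
   so one lemma excludes both infinite values. *)
have [r0 Sr0] : exists r, S r.
  apply: contrapT => /forallNP H.
  apply: (finite_section_not_all (sphereN w1)) => r.
  by rewrite opprK; exact: H.
have [r1 Sr1] : exists r, ~ S r.
  apply: contrapT => /forallNP H; apply: (finite_section_not_all w1) => r.
  by apply: finite_section_antipode => //; apply: contrapT; exact: H.
have ubS : has_sup S.
  split; first by exists r0.
  by exists r1 => r Sr; rewrite leNgt; apply/negP => rr; apply: Sr1; exact: down rr.
exists (sup S); split=> r hr.
  have [r' Sr' rr'] := sup_adherent (eps := sup S - r) (ltac:(lra)) ubS.
  by apply: (down r') => //; lra.
by move=> /(ub_le_sup ubS.2); lra.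
Qed.

End finite_section.

Lemma is_border_uniq tau w b c : is_border tau w b -> is_border tau w c -> b = c.
Proof.
move=> [b1 b2] [c1 c2]; apply: contrapT => /eqP; rewrite neq_lt => /orP[] h.
  by apply: (b2 ((b + c) / 2)); [|apply: c1]; lra.
by apply: (c2 ((b + c) / 2)); [|apply: b1]; lra.
Qed.

Lemma border_eq tau (w : @sphere R n) b : is_border tau (val w) b -> border tau w = b.
Proof.
move=> h; have hx : is_border tau (val w) (border tau w) by apply: xgetPex; exists b.
exact: is_border_uniq hx h.
Qed.

Lemma sphere_val (w : @sphere R n) : dot (val w) (val w) = 1.
Proof. exact: (set_valP w). Qed.

Lemma is_border_border tau (w : @sphere R n) : finite_sections tau ->
  is_border tau (val w) (border tau w).
Proof.
by move=> ft; exact: (xgetPex 0 (exists_is_border ft (sphere_val w))).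
Qed.

Lemma border_angle_lt tau (w : @sphere R n) s : finite_sections tau ->
  gd s < border_angle tau w -> tau (dS_param s (val w)).
Proof. by move=> /is_border_border bw; rewrite -/(gd _) gd_mono; exact: (bw _).1. Qed.

Lemma border_angle_gt tau (w : @sphere R n) s : finite_sections tau ->
  border_angle tau w < gd s -> ~ tau (dS_param s (val w)).
Proof. by move=> /is_border_border bw; rewrite -/(gd _) gd_mono; exact: (bw _).2. Qed.

Lemma border_angle_odd_lipschitz tau : finite_sections tau ->
  odd_lipschitz (border_angle tau).
Proof.
move=> ft; split=> [w|v w vw|].
- exact: gd_bound.
- rewrite /border_angle -!/(gd _) -gdN; congr gd; apply: border_eq.
  have w1 := sphere_val w; have [b1 b2] := is_border_border w ft.
  have w1' := sphereN w1; rewrite vw; split=> r hr.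
    (* A parameter strictly between the border at [w] and [- r]: it is not in the section at [w], so
       the corresponding closed side is chosen, and the remaining room puts [r] in the section at
       [- w]. *)
    have h : border tau w < (border tau w - r) / 2 by lra.
    have t := b2 _ h.
    apply: (finite_section_closed ft (r := - ((border tau w - r) / 2)) (v := - val w)) => //.
      by rewrite !opprK.
    by rewrite sphere_distxx// subr0 gd_mono; lra.
  rewrite -[r]opprK; apply: finite_section_antipode => //; apply: b1; lra.
have lip (v w : @sphere R n) :
    border_angle tau v - sphere_dist (val v) (val w) <= border_angle tau w.
  rewrite leNgt; apply/negP => h.
  have v1 := sphere_val v; have w1 := sphere_val w.
  have /andP[d0 _] := sphere_dist_itv v1 w1.
  have /andP[gv1 gv2] := gd_bound (border tau v).
  have /andP[gw1 gw2] := gd_bound (border tau w).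
  set d := sphere_dist _ _ in d0 h.
  change (is_true (gd (border tau w) < gd (border tau v) - d)) in h.
  set bv := gd (border tau v) in gv1 gv2 h; set bw := gd (border tau w) in gw1 gw2 h.
  (* The supposed gap [bv - d - bw] is cut in thirds: [s] lies above the border at [w], [r] below
     the border at [v], and the last third keeps the inclusion of caps strict. *)
  have [|s sE] := @gd_surj R (bw + (bv - d - bw) / 3).
    by apply/andP; split; lra.
  have [|r rE] := @gd_surj R (bv - (bv - d - bw) / 3).
    by apply/andP; split; lra.
  apply: (border_angle_gt (w := w) (s := s) ft).
    by rewrite sE /border_angle -/(gd _) -/bw; lra.
  apply: (finite_section_open ft (r := r) v1 w1).
    by apply: border_angle_lt => //; rewrite rE /border_angle -/(gd _) -/bv; lra.
  by rewrite sE rE -/d; lra.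
move=> v w; rewrite ler_norml; have := lip v w; have := lip w v.
by rewrite (sphere_dist_sym (val w)); lra.
Qed.

Lemma border_angle_eq_dS_measure0 tau tau' : finite_sections tau -> finite_sections tau' ->
  border_angle tau = border_angle tau' -> dS_measure (tau `+` tau') = 0%E.
Proof.
move=> ft ft' E; case: (ft) => td mt _ _; case: (ft') => td' mt' _ _.
(* The body of [border] also makes sense off the sphere, and on a point of the sphere it is [border]
   by conversion. *)
apply: (@dS_measure_graph0 _ _ _ (fun w => xget 0 [set b | is_border tau w b])).
  exact: measurable_setY.
move=> s w h.
have w1 : sphere w by case: h => [[/td/dS_dS_param]|[/td'/dS_dS_param]].
pose W : @sphere R n := exist _ w (mem_set w1).
have := is_border_border W ft'; have := is_border_border W ft.
have -> : border tau' W = border tau W.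
  by have /(congr1 (fun f => f W)) := E; rewrite /border_angle -!/(gd _) => /gd_inj.
rewrite -[xget _ _]/(border tau W) => -[b1 b2] [c1 c2].
have [lt|gt|//] := ltgtP s (border tau W).
- have h1 : tau (dS_param s w) := b1 _ lt; have h2 : tau' (dS_param s w) := c1 _ lt.
  by case: h => [[]|[]].
- have h1 : ~ tau (dS_param s w) := b2 _ gt; have h2 : ~ tau' (dS_param s w) := c2 _ gt.
  by case: h => [[]|[]].
Qed.

Lemma dS_measure_gt0_border tau tau' (w : @sphere R n) :
  finite_sections tau -> finite_sections tau' ->
  border_angle tau w < border_angle tau' w -> (0 < dS_measure (tau `+` tau'))%E.
Proof.
move=> ft ft' h; case: (ft) => _ mt _ _; case: (ft') => _ mt' _ _.
have [_ _ L] := border_angle_odd_lipschitz ft.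
have [_ _ L'] := border_angle_odd_lipschitz ft'.
have w1 := sphere_val w.
have /andP[a1 a2] : - (pi / 2) < border_angle tau w < pi / 2 := gd_bound _.
have /andP[a1' a2'] : - (pi / 2) < border_angle tau' w < pi / 2 := gd_bound _.
(* A quarter of the gap: at distance below [e] from [w] each border moves by less than [e], so
   angles between the two values shrunk by [e] stay between the borders. The cap of angular radius
   [e] is that of [t] with [gd t = pi / 2 - e]. *)
pose e := (border_angle tau' w - border_angle tau w) / 4.
have e0 : 0 < e by rewrite /e; lra.
have [|s1 E1] := @gd_surj R (border_angle tau w + e).
  by rewrite /e; apply/andP; split; lra.
have [|s2 E2] := @gd_surj R (border_angle tau' w - e).
  by rewrite /e; apply/andP; split; lra.
have [|t Et] := @gd_surj R (pi / 2 - e).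
  by rewrite /e; apply/andP; split; lra.
have s12 : s1 < s2 by rewrite -gd_mono E1 E2 /e; lra.
have [c c0 Hc] := sphere_measure_cap w1.
have mY := measurable_setY mt mt'.
have k0 : 0 < c / cosh t ^+ n.-1 by rewrite divr_gt0// exprn_gt0// cosh_gt0.
apply: (@lt_le_trans _ _ ((c / cosh t ^+ n.-1)%:E * @lebesgue_measure R `]s1, s2[)%E).
  by rewrite lebesgue_measure_itv/= lte_fin s12 -EFinB -EFinM lte_fin mulr_gt0// subr_gt0.
apply: dS_measure_ge => //; first exact: ltW.
move=> s /=; rewrite in_itv/= => /andP[ss1 ss2].
rewrite -[leLHS]mul1e; apply: lee_pmul => //; first by rewrite lee_fin ltW.
  by rewrite lee_fin exprn_ege1// cosh_ge1.
apply: Hc; first exact: measurable_dS_slice.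
move=> v v1 tv; right; have := cap_sphere_dist v1 w1 tv; rewrite Et => dv.
pose W : @sphere R n := exist _ v (mem_set (v1 : sphere v)).
have := L W w; have := L' W w; rewrite !ler_norml -[val W]/v => h1 h2.
move: ss1 ss2; rewrite -gd_mono E1 -[s < _]gd_mono E2 => ss1 ss2.
split.
  by apply: (border_angle_lt (w := W)) => //; lra.
by apply: (border_angle_gt (w := W)) => //; lra.
Qed.

Lemma dS_measure0_border_angle tau tau' : finite_sections tau -> finite_sections tau' ->
  dS_measure (tau `+` tau') = 0%E -> border_angle tau = border_angle tau'.
Proof.
move=> ft ft' m0; apply/funext => w; apply/eqP; apply: contraT.
rewrite neq_lt => /orP[/(dS_measure_gt0_border ft ft')|/(dS_measure_gt0_border ft' ft)].
  by rewrite m0 ltxx.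
by rewrite setYC m0 ltxx.
Qed.

End borders.

(** * The section with a prescribed border *)

Section surjectivity.
Context {R : realType} {n : nat}.
Local Notation V := 'rV[R]_(1 + n).
Implicit Types (r s h e : R) (v w x : 'rV[R]_n).

Lemma dS_param_inj r s v w : dot v v = 1 -> dot w w = 1 ->
  dS_param r v = dS_param s w -> (r, v) = (s, w).
Proof. by move=> hv hw E; apply: open_half_inj => //; rewrite E. Qed.

Lemma normalize_dS_param s v : dot v v = 1 -> normalize (rsubmx (dS_param s v)) = v.
Proof.
move=> hv; rewrite rsub_dS_param /normalize dotZl dotZr hv mulr1 -expr2 sqrtr_sqr.
have c0 := cosh_gt0 s.
by rewrite gtr0_norm// scalerA mulVf ?scale1r// lt0r_neq0.
Qed.

Lemma sinh_mono : {mono @sinh R : r s / r < s}.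
Proof.
apply: leW_mono; apply: le_mono => r s rs.
by rewrite /sinh ltr_pM2r// ltrB ?ltr_expR// ltrN2.
Qed.

Variable beta : @sphere R n -> R.
Hypothesis ol : odd_lipschitz beta.

(** [beta] lives on a subtype, while compactness and measurability are handled on sets of row
    vectors; the value off the sphere is the default 0. *)
Definition extend v : R :=
  xget 0 [set b | exists2 w : @sphere R n, val w = v & beta w = b].

Lemma extend_val (w : @sphere R n) : extend (val w) = beta w.
Proof.
rewrite /extend; apply: xget_subset1 => [|_ _ [x /val_inj-> <-] [y /val_inj-> <-]].
  by exists w.
by [].
Qed.

Lemma extendE v : dot v v = 1 -> exists2 w : @sphere R n, val w = v & extend v = beta w.
Proof.
by move=> hv; exists (exist _ v (mem_set (hv : sphere v))) => //; rewrite -extend_val.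
Qed.

Lemma extend_bound v : dot v v = 1 -> - (pi / 2) < extend v < pi / 2.
Proof. by move=> /extendE[w _ ->]; case: ol. Qed.

Lemma extendN v : dot v v = 1 -> extend (- v) = - extend v.
Proof.
move=> hv; have [w vw ->] := extendE hv; have [w' vw' ->] := extendE (sphereN hv).
by case: ol => _ + _; apply; rewrite vw vw'.
Qed.

Lemma extend_lipschitz v w : dot v v = 1 -> dot w w = 1 ->
  `|extend v - extend w| <= sphere_dist v w.
Proof.
by move=> /extendE[v' <- ->] /extendE[w' <- ->]; case: ol.
Qed.

Lemma extend_box v e : dot v v = 1 -> 0 < e -> exists2 h, 0 < h &
  forall x, dot x x = 1 -> box v h x -> `|extend v - extend x| < e.
Proof.
(* Capping at 1 keeps the angle inside the interval from 0 to pi where the cosine decreases. *)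
move=> hv e0; pose e' := Num.min e 1.
have e'0 : 0 < e' by rewrite lt_min e0 ltr01.
have e'1 : e' <= 1 by rewrite ge_min lexx orbT.
have e'e : e' <= e by rewrite ge_min lexx.
have pi2 := pi_ge2 R.
have ce : cos e' < 1 by rewrite -cos0 ltr_cos// in_itv/=; apply/andP; split; lra.
(* For unit vectors [1 - dot v x] is half the squared chord, hence at most [n h^2 / 2]; since
   [h <= 1], this choice brings it below [1 - cos e']. *)
pose h := Num.min 1 ((1 - cos e') / (n%:R + 1)).
have N0 : 0 <= n%:R :> R by [].
have h0 : 0 < h by rewrite lt_min ltr01 divr_gt0//; lra.
have h1 : h <= 1 by rewrite ge_min lexx.
have hN : h * (n%:R + 1) <= 1 - cos e'.
  by rewrite -ler_pdivlMr; [rewrite ge_min lexx orbT|lra].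
exists h => // x hx xb.
apply: (le_lt_trans (extend_lipschitz hv hx)); apply: (lt_le_trans _ e'e).
have [d0 dpi] := andP (sphere_dist_itv hv hx).
rewrite -ltr_cos ?in_itv/= ?d0//; last by apply/andP; split; lra.
rewrite cos_sphere_dist//.
have zb : box 0 h (x - v) by move=> i; have := xb i; rewrite !mxE subr0.
have := dot_box_le zb; rewrite !dotE (dotC x v) hx hv => h2.
have : n%:R * h ^+ 2 <= n%:R * h by rewrite ler_wpM2l// expr2; nra.
by lra.
Qed.

Lemma extend_continuous : {within @sphere R n, continuous extend}.
Proof.
apply/subspace_continuousP => v hv; apply/cvgrPdist_lt => e e0.
have [h h0 H] := extend_box hv e0.
rewrite near_withinE; apply/nbhs_ballP; exists h => // x vx hx.
by apply: H => // i; rewrite distrC; exact: (vx.2 0 i).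
Qed.

Lemma sphere_compact : compact (@sphere R n).
Proof.
apply: bounded_closed_compact.
  exists 1; split; first exact: num_real.
  move=> M M1 x hx; apply: ltW; apply: le_lt_trans M1.
  rewrite /Num.norm/= mx_normrE; apply: bigmax_le => // -[i j] _ /=.
  rewrite -(@ler_pXn2r _ 2) ?nnegrE// real_normK ?num_real// expr1n -[leRHS]hx.
  by rewrite /dot (bigD1 j)//= -expr2 (ord1 i) lerDl sumr_ge0// => k _; rewrite -expr2 sqr_ge0.
rewrite (_ : @sphere R n = (fun x => dot x x) @^-1` [set 1])//.
apply: closed_comp; last exact: closed_eq.
move=> x _; rewrite /dot.
have FF : Filter (nbhs x) by exact: nbhs_filter.
apply: (cvg_big _ FF) => [|i _]; first exact: add_continuous.
by apply: cvgM; exact: coord_continuous.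
Qed.

(** The maximum over the compact sphere is attained, hence below pi/2; oddness turns the upper bound
    into a lower one. *)
Lemma extend_uniform_bound : exists B, forall v, dot v v = 1 ->
  gd (- B) <= extend v <= gd B.
Proof.
have [[w0 hw0]|nS] := pselect (@sphere R n !=set0); last first.
  by exists 0 => v hv; exfalso; apply: nS; exists v.
have [c cS cmax] := EVT_max_rV (ex_intro _ w0 hw0) sphere_compact extend_continuous.
have hc : dot c c = 1 by move: cS; rewrite inE.
have [B EB] := gd_surj (extend_bound hc).
exists B => v hv; rewrite gdN EB.
have := cmax v (mem_set (hv : sphere v)).
have := cmax (- v) (mem_set (sphereN hv : sphere (- v))).
by rewrite extendN//; lra.
Qed.

Lemma rat_approx (t e : R) : 0 < e -> exists q : rat, `|t - ratr q| < e.
Proof.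
move=> e0; have [|q] := @rat_in_itvoo R (t - e) (t + e); first by lra.
by rewrite in_itv/= => /andP[q1 q2]; exists q; rewrite ltr_norml; lra.
Qed.

(* The superlevel set is relatively open, hence the trace on the sphere of a
   countable union of rational boxes. *)
Lemma measurable_extend_gt (a : R) :
  measurable (@sphere R n `&` [set v | a < extend v]).
Proof.
pose F (p : 'rV[rat]_n * nat) : set 'rV[R]_n :=
  box (map_mx ratr p.1) p.2.+1%:R^-1.
pose G p : set 'rV[R]_n :=
  if `[< @sphere R n `&` F p `<=` [set v | a < extend v] >] then F p else set0.
have -> : @sphere R n `&` [set v | a < extend v] = @sphere R n `&` \bigcup_p G p.
  apply/seteqP; split=> v [hv]; last first.
    move=> [p _]; rewrite /G; case: asboolP => // H vF; split=> //.
    by apply: H; split.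
  move=> /= av; split=> //.
  have [h h0 H] := extend_box hv (e := extend v - a) (ltac:(lra)).
  pose k := Num.truncn (2 / h).
  have k1 : 2 / h < k.+1%:R by exact: truncnS_gt.
  have k0 : 0 < k.+1%:R :> R by rewrite ltr0n.
  have kh : k.+1%:R^-1 *+ 2 < h.
    move: k1; rewrite ltr_pdivrMr// => k1.
    have u0 : 0 < k.+1%:R^-1 :> R by rewrite invr_gt0.
    have : k.+1%:R^-1 * 2 < k.+1%:R^-1 * (k.+1%:R * h) by rewrite ltr_pM2l.
    by rewrite mulKf ?lt0r_neq0// mulr_natr.
  have /choice[f fP] : forall i, exists q : rat, `|v 0 i - ratr q| < k.+1%:R^-1.
    by move=> i; apply: rat_approx; rewrite invr_gt0.
  have vF : F (\row_i f i, k) v by move=> i; rewrite !mxE; exact: fP.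
  exists (\row_i f i, k) => //; rewrite /G asboolT// => x [hx xF].
  have : `|extend v - extend x| < extend v - a.
    apply: H => // i; apply: lt_trans kh; rewrite mulr2n.
    rewrite -(subrKA ((map_mx ratr (\row_i f i) : 'rV[R]_n) 0 i)).
    apply: le_lt_trans (ler_normD _ _) _; apply: ltrD; first exact: xF.
    by rewrite distrC; exact: vF.
  by rewrite ltr_norml /=; lra.
apply: measurableI.
  rewrite (_ : @sphere R n = setT `&` (fun x => dot x x) @^-1` [set 1]).
    by apply: measurable_dot => //; exact: measurable_id.
  by rewrite setTI.
apply: countable_bigcupT_measurable; first exact: countableP.
by move=> p; rewrite /G; case: asboolP => _ //; exact: measurable_box.
Qed.

Definition border_of v : R := xget 0 [set b | gd b = extend v].

Lemma gd_border_of v : dot v v = 1 -> gd (border_of v) = extend v.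
Proof.
move=> /extend_bound/gd_surj[b bE].
by have /(xgetPex 0) : [set b | gd b = extend v] !=set0 by exists b.
Qed.

(* Points of the border itself are chosen only for negative [s]: this choice
   is antipodally consistent, and it respects inclusions of a closed half-space
   in an open one tangent to it at infinity, along which [s] decreases. *)
Definition below s (b : R) : Prop := s < b \/ (s = b /\ s < 0).

Definition section_of : set V := [set u | exists s v,
  [/\ dot v v = 1, u = dS_param s v & below s (border_of v)]].

Lemma section_ofE s v : dot v v = 1 ->
  section_of (dS_param s v) <-> below s (border_of v).
Proof.
move=> hv; split=> [[s' [v' [hv' E]]]|]; last by exists s, v.
by have [-> ->] := dS_param_inj hv hv' E.
Qed.

Lemma border_ofN v : dot v v = 1 -> border_of (- v) = - border_of v.
Proof.
move=> hv; apply: gd_inj.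
by rewrite gdN !gd_border_of ?extendN//; exact: sphereN.
Qed.

Lemma section_of_admissible : admissible section_of.
Proof.
apply/admissibleP; split=> [r v hv /(section_ofE _ hv)|r v s w hv hw].
  by move=> b1 /(section_ofE _ (sphereN hv)); rewrite border_ofN//; move: b1; rewrite /below; lra.
move=> nt c ne; apply/section_ofE => //.
(* The failure of the antipodal point to be chosen, with the tie rule and oddness, leaves [r] below
   the border, or on it with [r <= 0]. *)
have rb : r < border_of v \/ (r = border_of v /\ r <= 0).
  have [||E] := ltgtP r (border_of v); [by left|move=> gt|right; split=> //].
    by exfalso; apply: nt; apply/(section_ofE _ (sphereN hv)); left; rewrite border_ofN//; lra.
  rewrite leNgt; apply/negP => r0; apply: nt; apply/(section_ofE _ (sphereN hv)).
  by right; rewrite border_ofN//; lra.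
have /andP[d0 _] := sphere_dist_itv hv hw.
have := extend_lipschitz hv hw; rewrite -!gd_border_of// ler_norml => /andP[_ L].
have ge : gd s <= gd (border_of w).
  have : gd r <= gd (border_of v).
    by case: rb => [|[->]//]; rewrite -gd_mono => /ltW.
  by move: c; rewrite /cap_le; lra.
(* If [s] is on the border at [w], every inequality used is an equality: [r] is on the border,
   [r <= 0] and [gd s = gd r - d]. So [s <= 0], and [s = 0] would force [d = 0] and equal
   parameters. *)
move: ge; rewrite le_eqVlt => /orP[/eqP E|]; last by rewrite gd_mono; left.
right; split; first exact: gd_inj.
have [rE r0] : r = border_of v /\ r <= 0.
  case: rb => // ; rewrite -gd_mono => lt; exfalso.
  by move: c; rewrite /cap_le; lra.
have gr0 : gd r <= 0.
  by move: r0; rewrite le_eqVlt => /orP[/eqP->|]; rewrite ?gd0// -gd_mono gd0 => /ltW.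
rewrite -gd_mono gd0 lt_neqAle; apply/andP; split; last by move: c; rewrite /cap_le; lra.
apply/eqP => s0; apply: ne.
have vw : v = w by apply: sphere_dist0 => //; move: c; rewrite /cap_le; lra.
congr (_, _) => //; apply: gd_inj; move: c; rewrite /cap_le; lra.
Qed.

Lemma section_of_dS : section_of `<=` @dS R n.
Proof. by move=> _ [s [v [hv -> _]]]; apply/dS_dS_param. Qed.

(** The border enters through [sinh] because the time coordinate of [dS_param s v] is [sinh s];
    membership in the section then compares this coordinate with a measurable function of the
    direction. *)
Lemma measurable_border_of :
  measurable_fun setT (fun v : 'rV[R]_n => if v \in @sphere R n then sinh (border_of v) else 0).
Proof.
have mS : measurable (@sphere R n).
  rewrite (_ : @sphere R n = setT `&` (fun x => dot x x) @^-1` [set 1]).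
    by apply: measurable_dot => //; exact: measurable_id.
  by rewrite setTI.
move=> mT; apply: (measurability _ (RGenOInfty.measurableE R)) => //.
move=> /= _ [_ [a ->] <-]; rewrite setTI.
have [t tE] := sinh_surj a.
rewrite (_ : _ @^-1` _ = (@sphere R n `&` [set v | gd t < extend v]) `|`
    (~` @sphere R n `&` [set _ | a < 0])); last first.
  apply/seteqP; split=> v /=; rewrite in_itv/= andbT.
    case: ifPn => [/set_mem hv|/negP hv] av.
      by left; split=> //; rewrite -gd_border_of// gd_mono -sinh_mono tE.
    by right; split=> // /mem_set.
  move=> [[hv]|[hv]] h.
    by rewrite mem_set// -tE sinh_mono -gd_mono gd_border_of.
  by rewrite memNset.
apply: measurableU; first exact: measurable_extend_gt.
apply: measurableI; first exact: measurableC.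
by case: (ltP a 0) => _; [rewrite set_true|rewrite set_false].
Qed.

Lemma measurable_section_of : measurable section_of.
Proof.
pose g (u : V) := let v := normalize (rsubmx u) in
  if v \in @sphere R n then sinh (border_of v) else 0.
have mg : measurable_fun setT g.
  apply: (measurableT_comp measurable_border_of).
  apply: (measurableT_comp (@measurable_normalize R n)).
  exact: measurable_rsubmx.
have ml := @measurable_lsubmx00 R n.
rewrite (_ : section_of = @dS R n `&`
   ([set u | lsubmx u 0 0 < g u] `|`
    ([set u | lsubmx u 0 0 == g u] `&` [set u | lsubmx u 0 0 < 0]))).
  have mb (f : V -> bool) : measurable_fun setT f -> measurable [set u | f u].
    move=> mf; rewrite (_ : [set u | f u] = setT `&` f @^-1` [set true]); first exact: mf.
    by rewrite setTI.
  apply: measurableI; first exact: measurable_dS.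
  apply: measurableU; first by apply: mb; exact: measurable_fun_ltr.
  apply: measurableI; first by apply: mb; exact: measurable_fun_eqr.
  by apply: mb; apply: measurable_fun_ltr => //; exact: measurable_cst.
have K s v : dot v v = 1 ->
    ((s < border_of v) = (lsubmx (dS_param s v) 0 0 < g (dS_param s v))) *
    ((s == border_of v) = (lsubmx (dS_param s v) 0 0 == g (dS_param s v))) *
    ((s < 0) = (lsubmx (dS_param s v) 0 0 < 0)).
  move=> hv; rewrite lsub_dS_param /g normalize_dS_param// mem_set// sinh_mono.
  have -> : (s < 0) = (sinh s < 0).
    by rewrite -(sinh_mono s 0) /sinh oppr0 subrr mul0r.
  do 2 split=> //; apply/eqP/eqP => [->//|E].
  by apply: le_anti; rewrite !leNgt -(sinh_mono s) -(sinh_mono _ s) E ltxx.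
apply/seteqP; split=> [u tu|u [/dS_paramP[s [v [hv ->]]]]].
  split; first exact: section_of_dS.
  case: tu => s [v [hv -> [|[/eqP]]]]; first by rewrite (K s v hv); left.
  by rewrite !(K s v hv); right.
by rewrite /= -!(K s v hv) => h; apply/section_ofE => //; case: h => [|[/eqP]]; [left|right].
Qed.

Lemma section_of_finite : finite_sections section_of.
Proof.
split.
- exact: section_of_dS.
- exact: measurable_section_of.
- exact: section_of_admissible.
have [B HB] := extend_uniform_bound.
(* The maximum with 0 makes the slab contain the border [s = 0] of the base section as well. *)
apply: (@dS_measure_slab_lty _ _ _ (Num.max B 0)).
  by apply: measurable_setY; [exact: measurable_section_of|exact: measurable_point_section].
have Bb v : dot v v = 1 -> - B <= border_of v <= B.
  move=> /[dup] hv /HB; rewrite -gd_border_of//.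
  by rewrite !leNgt !gd_mono.
have m1 : B <= Num.max B 0 by rewrite le_max lexx.
have m2 : 0 <= Num.max B 0 by rewrite le_max lexx orbT.
move=> s v [[st ns]|[/base_point_section[hv s0] ns]].
  have hv : dot v v = 1 by apply/(@dS_dS_param _ _ s); exact: section_of_dS.
  have s0 : 0 <= s by rewrite leNgt; apply/negP => s0; apply: ns; apply/base_point_section.
  have := Bb v hv; move/(section_ofE _ hv): st; rewrite /below => -[|[]]; lra.
have := Bb v hv; have : border_of v <= s.
  by rewrite leNgt; apply/negP => h; apply: ns; apply/section_ofE => //; left.
by lra.
Qed.

Lemma border_angle_section_of : border_angle section_of = beta.
Proof.
apply/funext => w; have hw := sphere_val w.
rewrite /border_angle (border_eq (b := border_of (val w))).
  by rewrite -/(gd _) gd_border_of// extend_val.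
by split=> r hr; [apply/section_ofE => //; left|move=> /(section_ofE _ hw); rewrite /below; lra].
Qed.

End surjectivity.

Theorem theorem1p2 (R : realType) (n : nat) (hn : (2 <= n)%N) :
  exists F : set (set 'rV[R]_(1 + n)) -> (@sphere R n -> R),
    (forall tau : set 'rV[R]_(1 + n), finite_sections tau ->
       F (section_class tau) = border_angle tau) /\
    set_bij section_classes odd_lipschitz F.
Proof.
(* Classes are the fibres of [border_angle], so its value at any representative determines the
   class; injectivity follows. *)
have classE (tau : set 'rV[R]_(1 + n)) : finite_sections tau -> section_class tau =
    [set tau' | finite_sections tau' /\ border_angle tau' = border_angle tau].
  move=> ft; apply/seteqP; split=> tau' [ft' h]; split=> //.
    by rewrite (dS_measure0_border_angle ft ft' h).
  exact: border_angle_eq_dS_measure0.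
(* A representative is picked by [xget]; the default [set0] is never reached on a class, which
   contains its own section. *)
pose F (C : set (set 'rV[R]_(1 + n))) := border_angle (xget set0 C).
have FE (tau : set 'rV[R]_(1 + n)) : finite_sections tau ->
    F (section_class tau) = border_angle tau.
  move=> ft; rewrite classE// /F.
  by case: (xgetPex set0 (ex_intro (fun t => finite_sections t /\
    border_angle t = border_angle tau) tau (conj ft erefl))).
exists F; split=> //; split.
- by move=> _ [tau ft <-]; rewrite FE//; exact: border_angle_odd_lipschitz.
- move=> _ _ /set_mem[tau ft <-] /set_mem[tau' ft' <-].
  by rewrite !FE// => E; rewrite !classE// E.
- move=> beta ol; exists (section_class (section_of beta)).
    by exists (section_of beta) => //; exact: section_of_finite.
  by rewrite FE ?border_angle_section_of//; exact: section_of_finite.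
Qed.
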